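(* Let $q$ be a power of an odd prime $p$, let $M\geq2$ be an integer written as $M=t\cdot p^r$ with $p\nmid t$, $r\ge0$, and for $n\ge1$ let $a_n=\#\{x\in\mathrm{GL}_n(\mathbb{F}_q): x^M=\mathrm{Id}_n\}$. Then, as formal power series in $z$, $$1+\sum_{n=1}^{\infty}\frac{a_n}{|\mathrm{GL}_n(\mathbb{F}_q)|}z^n=\prod_{d\mid t}\left(1+\sum_{m\geq1}\ \sum_{\substack{\lambda\vdash m\\ \lambda_1\leq p^r}}\frac{z^{m\,e(d)}}{q^{e(d)\sum_i(\lambda_i')^2}\prod_{i\geq1}\prod_{j=1}^{m_i(\lambda)}\bigl(1-q^{-e(d)j}\bigr)}\right)^{\phi(d)/e(d)}.$$
   Context: $\phi$ is Euler's totient function; for a positive integer $d$ coprime to $q$, $e(d)$ is the multiplicative order of $q$ in $(\mathbb{Z}/d\mathbb{Z})^\times$ ($e(1)=1$). For a partition $\lambda$, $\lambda_1$ is its largest part, $\lambda'$ is its transpose (conjugate) partition with parts $\lambda'_1\ge\lambda'_2\ge\cdots$, and $m_i(\lambda)$ is the number of parts of $\lambda$ equal to $i$; an empty inner product equals $1$. *)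

(* Defs.v *)
From HB Require Import structures.
From mathcomp Require Import all_boot all_order all_algebra all_fingroup all_field.
Set Implicit Arguments. Unset Strict Implicit. Unset Printing Implicit Defensive.
Import Order.TTheory GRing.Theory Num.Theory.
Local Open Scope ring_scope.

Definition ps := nat -> rat.
Definition ps_one : ps := fun n => if n == 0%N then 1 else 0.
Definition ps_mul (f g : ps) : ps :=
  fun n => \sum_(i < n.+1) f i * g (n - i)%N.
Definition ps_pow (f : ps) (k : nat) : ps := iter k (ps_mul f) ps_one.
Definition ps_prod (s : seq ps) : ps := foldr ps_mul ps_one s.

(* smallest k >= 1 with q^k = 1 (mod d); for such d it is <= d; e(1) = 1 *)
Definition mord (q d : nat) : nat :=
  head 0%N [seq k <- iota 1 d | q ^ k == 1 %[mod d]].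

(* A partition of m is encoded by its parts listed in nonincreasing order and
   padded with zeros to length m (every partition of m has at most m parts). *)
Definition is_partition_code (m : nat) (f : {ffun 'I_m -> 'I_m.+1}) : bool :=
  [forall i : 'I_m, forall j : 'I_m, (i <= j)%N ==> (f j <= f i)%N]
  && (\sum_(i < m) (f i : nat) == m)%N.

Definition parts (m : nat) (f : {ffun 'I_m -> 'I_m.+1}) : seq nat :=
  [seq x <- [seq (f i : nat) | i <- enum 'I_m] | (0 < x)%N].

Definition lam1 (l : seq nat) : nat := head 0%N l.
Definition conjp (l : seq nat) (j : nat) : nat := count (fun x => j <= x)%N l.
Definition multp (l : seq nat) (i : nat) : nat := count (pred1 i) l.

Definition part_term (q e : nat) (l : seq nat) : rat :=
  let Q : rat := q%:R in
  (Q ^+ (e * \sum_(1 <= i < (sumn l).+1) (conjp l i) ^ 2)%N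
   * \prod_(1 <= i < (sumn l).+1) \prod_(1 <= j < (multp l i).+1)
        (1 - (Q ^+ (e * j)%N)^-1))^-1.

Definition factor_ps (q e bound : nat) : ps := fun N =>
  if N == 0%N then 1
  else if (e %| N)%N then
    let m := (N %/ e)%N in
    \sum_(f : {ffun 'I_m -> 'I_m.+1} |
           is_partition_code f && (lam1 (parts f) <= bound)%N)
       part_term q e (parts f)
  else 0.

Definition GLcard (F : finFieldType) (n : nat) : nat :=
  #|[set A : 'M[F]_n | A \in unitmx]|.
Definition a_count (F : finFieldType) (M n : nat) : nat :=
  #|[set A : 'M[F]_n | (A \in unitmx) && (A ^+ M == 1)]|.

Definition lhs_ps (F : finFieldType) (M : nat) : ps := fun n =>
  if n == 0%N then 1 else (a_count F M n)%:R / (GLcard F n)%:R.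

Definition rhs_ps (q t bound : nat) : ps :=
  ps_prod [seq ps_pow (factor_ps q (mord q d) bound) (totient d %/ mord q d)
          | d <- divisors t].

(* Main.v *)
Require Import Defs.
From HB Require Import structures.
From mathcomp Require Import all_boot all_order all_algebra all_fingroup all_field.
From mathcomp Require Import qpoly qfpoly ring zify.
Set Implicit Arguments. Unset Strict Implicit. Unset Printing Implicit Defensive.
Import Order.TTheory GRing.Theory Num.Theory.
Local Open Scope ring_scope.

(** For a polynomial f over F, let Z(f) be the series with coefficients
    #{A in M_n(F) | f(A) = 0} / |GL_n(F)|.  Since X^M - 1 = (X^t - 1)^(p^r), the
    left-hand side is Z((X^t - 1)^(p^r)).

    Z is multiplicative on coprime polynomials, because F^n splits canonically
    as ker f(A) + ker g(A).  As X^t - 1 is separable and each cyclotomic factor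
    Phi_d is over F a product of totient(d)/e(d) irreducibles of degree e(d), only
    Z(phi^s) for phi irreducible of degree e is needed.  With K = F[X]/(phi),
    every A killed by phi^s is conjugate to the restriction of scalars of
    x + N, where N in M_m(K), N^s = 0, n = m e and x is the class of X; N is
    unique up to GL_m(K)-conjugacy because x = (x + N)^(|K|^j) for large j.
    Hence Z(phi^s) counts nilpotent matrices over K.  These are classified by
    restricting N to its image: if a is the corank of N and b that of the
    restriction, the normalized counts satisfy the recurrence
    g(s+1,a,m) = |K|^(-a^2) sum_(b <= a) g(s,b,m-a) / (1/|K|; 1/|K|)_(a-b),
    which is also what removing the first column of a partition with a parts
    gives for the right-hand side. *)

(** Each fibre of [h] over [Y] is a single free orbit, so it has [#|H|] elements. No group law on
    [H] is assumed, so pairs and triples of matrices can serve as [H] directly. All the double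
    counts below have this shape. *)
Lemma card_torsor (T U V : finType) (X : {set T}) (Y : {set U}) (H : {set V})
    (h : T -> U) (act : V -> T -> T) :
  (forall x, x \in X -> h x \in Y) ->
  (forall y, y \in Y -> exists2 x, x \in X & h x = y) ->
  (forall v x, v \in H -> x \in X -> act v x \in X /\ h (act v x) = h x) ->
  (forall x, x \in X -> {in H &, injective (act ^~ x)}) ->
  (forall x x', x \in X -> x' \in X -> h x = h x' ->
     exists2 v, v \in H & x' = act v x) ->
  #|X| = (#|H| * #|Y|)%N.
Proof.
move=> hXY hsurj hact hinj htrans.
rewrite -sum1_card (partition_big h [in Y]) //=.
rewrite mulnC -sum_nat_const; apply: eq_bigr => y /hsurj[x xX <-].
rewrite -(card_in_imset (hinj x xX)) -sum1_card; apply: eq_bigl => x'.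
apply/andP/imsetP => [[x'X /eqP hx']|[v vH ->]].
  by have [v vH ->] := htrans x x' xX x'X (esym hx'); exists v.
by have [-> ->] := hact v x vH xX.
Qed.

(** * Polynomials in a matrix and the coprime splitting *)

Section PolyEval.
Variable F : fieldType.

(* [horner_mx] only exists in positive dimension. *)
Definition peval (n : nat) : 'M[F]_n -> {poly F} -> 'M[F]_n :=
  match n with
  | 0 => fun _ _ => 0
  | n'.+1 => fun A f => horner_mx A f
  end.

Lemma peval_is_zmod_morphism n (A : 'M[F]_n) : zmod_morphism (peval A).
Proof. by case: n A => [|n] A f g; rewrite /= ?subrr ?rmorphB. Qed.

Lemma peval_is_monoid_morphism n (A : 'M[F]_n) : monoid_morphism (peval A).
Proof.
case: n A => [|n] A; split => [|f g] /=; rewrite ?rmorph1 ?rmorphM //.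
  by apply/matrixP => -[].
by rewrite mul0r.
Qed.

HB.instance Definition _ n (A : 'M[F]_n) :=
  GRing.isZmodMorphism.Build {poly F} 'M[F]_n (peval A)
    (peval_is_zmod_morphism A).
HB.instance Definition _ n (A : 'M[F]_n) :=
  GRing.isMonoidMorphism.Build {poly F} 'M[F]_n (peval A)
    (peval_is_monoid_morphism A).

Lemma pevalX n (A : 'M[F]_n) : peval A 'X = A.
Proof. by case: n A => [|n] A /=; [apply/matrixP => -[]|rewrite horner_mx_X]. Qed.

Lemma pevalC n (A : 'M[F]_n) c : peval A c%:P = c%:M.
Proof. by case: n A => [|n] A /=; [apply/matrixP => -[]|rewrite horner_mx_C]. Qed.

(* [P *m A = B *m P] rather than [A = P^-1 B P], so that [P] may be
   rectangular. *)
Lemma peval_intertwine m n (P : 'M[F]_(m, n)) (A : 'M_n) (B : 'M_m) f :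
  P *m A = B *m P -> P *m peval A f = peval B f *m P.
Proof.
move=> PA; elim/poly_ind: f => [|f c IH]; first by rewrite !rmorph0 mulmx0 mul0mx.
rewrite !rmorphD !rmorphM /= !pevalX !pevalC -!mulmxE mulmxDr mulmxDl.
by rewrite mulmxA IH -!mulmxA PA mul_mx_scalar mul_scalar_mx.
Qed.

Lemma peval_block_diag m n (A : 'M[F]_m) (B : 'M_n) f :
  peval (block_mx A 0 0 B) f = block_mx (peval A f) 0 0 (peval B f).
Proof.
elim/poly_ind: f => [|f c IH]; first by rewrite !rmorph0 block_mx0.
rewrite !rmorphD !rmorphM /= !pevalX !pevalC IH -!mulmxE mulmx_block.
rewrite !mul0mx !mulmx0 !addr0 !add0r scalar_mx_block add_block_mx.
by rewrite !addr0.
Qed.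

End PolyEval.

Section CoprimeSplit.
Variable F : finFieldType.

(* [pser f] is the series Z(f) of the header. *)
Definition pcount (f : {poly F}) n := #|[set A : 'M[F]_n | peval A f == 0]|.
Definition pser (f : {poly F}) : ps := fun n => (pcount f n)%:R / (GLcard F n)%:R.

Lemma GLcard_gt0 n : (0 < GLcard F n)%N.
Proof. by apply/card_gt0P; exists 1%:M; rewrite inE unitmx1. Qed.

Lemma GLcard_neq0 n : (GLcard F n)%:R != 0 :> rat.
Proof. by rewrite pnatr_eq0 -lt0n GLcard_gt0. Qed.

Lemma pser0 f : pser f 0 = 1.
Proof.
have E : pcount f 0 = GLcard F 0.
  apply: eq_card => A; rewrite !inE unitmxE det_mx00 unitr1.
  by apply/eqP/matrixP => -[].
by rewrite /pser E divff // GLcard_neq0.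
Qed.

Lemma card_pair_set (T U : finType) (P : pred T) (Q : pred U) :
  #|[set x : T * U | P x.1 && Q x.2]| = (#|[set x | P x]| * #|[set y | Q y]|)%N.
Proof. by rewrite -cardsX; apply: eq_card => x; rewrite !inE. Qed.

Lemma unitmx_block_lower m n (A : 'M[F]_m) (B : 'M_n) C :
  (block_mx A 0 C B \in unitmx) = (A \in unitmx) && (B \in unitmx).
Proof. by rewrite !unitmxE det_lblock unitrM. Qed.

Lemma conj_eq n (P A B : 'M[F]_n) : P \in unitmx ->
  (invmx P *m A *m P = B) <-> (A *m P = P *m B).
Proof.
move=> Pu; split => [<-|E]; first by rewrite !mulmxA mulmxV // mul1mx.
by rewrite -mulmxA E mulKmx.
Qed.

Lemma peval_conj n (P A : 'M[F]_n) f : P \in unitmx ->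
  peval (invmx P *m A *m P) f = invmx P *m peval A f *m P.
Proof.
move=> Pu; apply/esym/conj_eq => //; apply/esym/peval_intertwine.
by apply/esym/conj_eq.
Qed.

(** A Bezout identity evaluated at [A] exhibits an inverse of [peval A g]. *)
Lemma coprime_unit n (A : 'M[F]_n) f g :
  coprimep f g -> peval A f = 0 -> peval A g \in unitmx.
Proof.
case/Bezout_eq1_coprimepP => -[u v] /= /(congr1 (peval A)).
rewrite rmorphD !rmorphM rmorph1 /= => + fA0; rewrite fA0 mulr0 add0r -mulmxE.
by case/mulmx1_unit.
Qed.

(** The rows of [P] are a basis [X] of the image of g(A) followed by a basis [Y] of the image of
    f(A). Both images are stable under [A], the first is killed by f(A) and the second by g(A), and
    by Bezout they span the space; [B] and [C] are the two restrictions of [A]. *)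
Lemma coprime_basis i j (A : 'M[F]_(i + j)) f g :
  coprimep f g -> peval A (f * g) = 0 -> \rank (peval A g) = i ->
  exists P B C, [/\ P \in unitmx, peval B f = 0, peval C g = 0 &
    invmx P *m block_mx B 0 0 C *m P = A].
Proof.
move=> cop fgA rk; have [[u v] /= uv] := Bezout_eq1_coprimepP _ _ cop.
have fgA' : peval A f *m peval A g = 0 by rewrite mulmxE -rmorphM.
have gfA' : peval A g *m peval A f = 0 by rewrite mulmxE -rmorphM mulrC.
have one : peval A u *m peval A f + peval A v *m peval A g = 1%:M.
  by rewrite !mulmxE -!rmorphM -rmorphD uv rmorph1.
(* The upper bound comes from f(A) g(A) = 0, the lower bound from [one], which forces the two ranks
   to add up to at least [i + j]. *)
have rkf : \rank (peval A f) = j.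
  apply/eqP; rewrite eqn_leq; apply/andP; split.
    by have := mulmx0_rank_max fgA'; rewrite rk addnC leq_add2l.
  rewrite -(leq_add2l i) -[leqLHS](mxrank1 F) -one.
  rewrite (leq_trans (mxrank_add _ _)) // addnC leq_add ?mxrankM_maxr //.
  by rewrite -[leqRHS]rk mxrankM_maxr.
have comm h : A *m peval A h = peval A h *m A by rewrite (peval_intertwine (B := A)).
pose X : 'M_(i, i + j) := castmx (rk, erefl) (row_base (peval A g)).
pose Y : 'M_(j, i + j) := castmx (rkf, erefl) (row_base (peval A f)).
have eX : (X :=: peval A g)%MS by apply: eqmx_trans (eqmx_cast _ _) (eq_row_base _).
have eY : (Y :=: peval A f)%MS by apply: eqmx_trans (eqmx_cast _ _) (eq_row_base _).
have Xf : X *m peval A f = 0.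
  have /submxP[Z ->] : (X <= peval A g)%MS by rewrite eX.
  by rewrite -mulmxA gfA' mulmx0.
have Yg : Y *m peval A g = 0.
  have /submxP[Z ->] : (Y <= peval A f)%MS by rewrite eY.
  by rewrite -mulmxA fgA' mulmx0.
have /submxP[B XA] : (X *m A <= X)%MS.
  by rewrite eX (eqmxMr _ eX) -comm submxMl.
have /submxP[C YA] : (Y *m A <= Y)%MS.
  by rewrite eY (eqmxMr _ eY) -comm submxMl.
have frX : row_free X by rewrite /row_free eX rk.
have frY : row_free Y by rewrite /row_free eY rkf.
have Pu : col_mx X Y \in unitmx.
  rewrite -row_full_unit -sub1mx -addsmxE (adds_eqmx eX eY) -one addrC.
  by rewrite addmx_sub_adds ?submxMl.
exists (col_mx X Y), B, C; split => //.
- have := peval_intertwine f XA; rewrite Xf => /esym/eqP.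
  by rewrite mulmx_free_eq0 // => /eqP.
- have := peval_intertwine g YA; rewrite Yg => /esym/eqP.
  by rewrite mulmx_free_eq0 // => /eqP.
- apply/conj_eq => //.
  by rewrite mul_block_col !mul0mx addr0 add0r mul_col_mx XA YA.
Qed.

Lemma peval_conj_diag i j P (B : 'M[F]_i) (C : 'M_j) h : P \in unitmx ->
  peval (invmx P *m block_mx B 0 0 C *m P) h =
  invmx P *m block_mx (peval B h) 0 0 (peval C h) *m P.
Proof. by move=> Pu; rewrite peval_conj // peval_block_diag. Qed.

(** The map sending (P, (B, C)) to the conjugate of diag(B, C) by [P] has fibres that are torsors
    for GL_i x GL_j, because a matrix intertwining two such block diagonals is itself block
    diagonal. *)
Lemma card_coprime_split i j f g : coprimep f g ->
  (GLcard F (i + j) * (pcount f i * pcount g j) =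
   (GLcard F i * GLcard F j) *
   #|[set A : 'M[F]_(i + j) | (peval A (f * g) == 0%R) &&
                              (\rank (peval A g) == i)]|)%N.
Proof.
move=> cop; rewrite /GLcard /pcount -[in LHS]card_pair_set -[in LHS]card_pair_set.
rewrite -(card_pair_set [in unitmx] [in unitmx]).
pose h (x : 'M[F]_(i + j) * ('M[F]_i * 'M[F]_j)) :=
  invmx x.1 *m block_mx x.2.1 0 0 x.2.2 *m x.1.
pose act (v : 'M[F]_i * 'M[F]_j) (x : 'M[F]_(i + j) * ('M[F]_i * 'M[F]_j)) :=
  (block_mx v.1 0 0 v.2 *m x.1,
   (v.1 *m x.2.1 *m invmx v.1, v.2 *m x.2.2 *m invmx v.2)).
apply: (@card_torsor _ _ _ _ _ _ h act).
- case=> P [B C]; rewrite !inE /h /= => /and3P[Pu /eqP fB /eqP gC].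
  rewrite !peval_conj_diag // !rmorphM /= fB gC mul0r mulr0.
  rewrite block_mx0 mulmx0 mul0mx eqxx /=.
  rewrite mxrankMfree ?row_free_unit // (eqmxMfull _) ?row_full_unit ?unitmx_inv //.
  rewrite rank_diag_block_mx mxrank0 addn0 eqn_leq rank_leq_row /=.
  by have := coprime_unit cop fB; rewrite -row_free_unit => /eqP->.
- move=> A; rewrite inE => /andP[/eqP fgA /eqP rk].
  have [P [B [C [Pu fB gC E]]]] := coprime_basis cop fgA rk.
  by exists (P, (B, C)); rewrite ?inE /= ?Pu ?fB ?gC ?eqxx.
- case=> R T [P [B C]]; rewrite !inE /h /act /= => /andP[Ru Tu].
  case/and3P=> Pu /eqP fB /eqP gC.
  have Du : block_mx R 0 0 T \in unitmx by rewrite unitmx_block_lower Ru.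
  have D P' (Z : 'M[F]_P') V k : Z \in unitmx -> peval V k = 0 ->
      peval (Z *m V *m invmx Z) k = 0.
    move=> Zu Vk; rewrite -{1}(invmxK Z) peval_conj ?unitmx_inv // Vk.
    by rewrite mulmx0 mul0mx.
  rewrite unitmx_mul Du Pu !D // !eqxx; split => //.
  apply/conj_eq; first by rewrite unitmx_mul Du.
  rewrite -!mulmxA mulKVmx // !mulmxA; congr (_ *m _).
  rewrite !mulmx_block !mul0mx !mulmx0 !addr0 !add0r.
  by rewrite -!mulmxA !mulVmx // !mulmx1.
- case=> P [B C]; rewrite !inE /= => /andP[Pu _] [R T] [R' T'] _ _ [+ _ _].
  move/(congr1 (mulmx^~ (invmx P))); rewrite !mulmxK // => /eq_block_mx.
  by case=> -> _ _ ->.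
- case=> P [B C] [P' [B' C']]; rewrite !inE /h /=.
  case/and3P=> Pu /eqP fB /eqP gC /and3P[Pu' /eqP fB' /eqP gC'] E.
  pose T := P' *m invmx P.
  have Tu : T \in unitmx by rewrite unitmx_mul Pu' unitmx_inv.
  have TE : T *m block_mx B 0 0 C = block_mx B' 0 0 C' *m T.
    have -> : block_mx B 0 0 C =
        P *m (invmx P' *m block_mx B' 0 0 C' *m P') *m invmx P.
      by rewrite -E !mulmxA mulmxV // mul1mx mulmxK.
    by rewrite /T !mulmxA mulmxKV // mulmxV // mul1mx.
  move: TE Tu; rewrite -(submxK T); set T11 := ulsubmx T; set T12 := ursubmx T.
  set T21 := dlsubmx T; set T22 := drsubmx T.
  rewrite !mulmx_block !mul0mx !mulmx0 !addr0 !add0r => /eq_block_mx[E11 E12 E21 E22].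
  (* By [E12], T12 f(C) = f(B') T12 = 0, while f(C) is invertible because g(C) = 0. The block [T21]
     is treated symmetrically. *)
  have T12_0 : T12 = 0.
    have := peval_intertwine f E12; rewrite fB' mul0mx => /eqP.
    rewrite coprimep_sym in cop.
    by rewrite mulmx_free_eq0 ?row_free_unit ?(coprime_unit cop) // => /eqP.
  have T21_0 : T21 = 0.
    have := peval_intertwine g E21; rewrite gC' mul0mx => /eqP.
    by rewrite mulmx_free_eq0 ?row_free_unit ?(coprime_unit cop) // => /eqP.
  rewrite T12_0 T21_0 unitmx_block_lower => /andP[u1 u2].
  exists (T11, T22); first by rewrite inE u1.
  rewrite /act /= E11 E22 !mulmxK //; congr (_, _).
  by rewrite -[in RHS]T12_0 -[X in block_mx _ _ X _]T21_0 submxK mulmxKV.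
Qed.

(** Sorting the matrices killed by f g according to the rank [i] of g(A) turns [card_coprime_split]
    into the Cauchy product. *)
Lemma pserM f g n : coprimep f g -> pser (f * g) n = ps_mul (pser f) (pser g) n.
Proof.
move=> cop; rewrite /pser /ps_mul.
have nz := GLcard_neq0.
have -> : pcount (f * g) n =
    (\sum_(i < n.+1) #|[set A : 'M[F]_n | (peval A (f * g) == 0%R) &&
                              (\rank (peval A g) == i)]|)%N.
  rewrite /pcount -sum1_card.
  rewrite (partition_big (fun A => inord (\rank (peval A g)) : 'I_n.+1) xpredT) //=.
  apply: eq_bigr => i _; rewrite -sum1_card; apply: eq_bigl => A.
  rewrite !inE; congr andb.
  by rewrite -val_eqE /= inordK ?ltnS ?rank_leq_row.
rewrite natr_sum mulr_suml; apply: eq_bigr => i _.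
case: i => i /=; rewrite ltnS => le_in; have := subnKC le_in.
move: (n - i)%N => j E; case: n / E {le_in}.
have := card_coprime_split i j cop => /(congr1 (fun x => x%:R : rat)).
rewrite !natrM => E; rewrite mulf_div.
by apply/eqP; rewrite eqr_div ?mulf_neq0 //; apply/eqP; rewrite [LHS]mulrC [RHS]mulrC E.
Qed.
End CoprimeSplit.

(** * Nilpotent matrices *)

Section Nilpotent.
Variable F : finFieldType.

Definition nilcount s m := #|[set N : 'M[F]_m | N ^+ s == 0]|.
Definition nilrank s m k :=
  #|[set N : 'M[F]_m | (N ^+ s == 0) && (\rank N == k)]|.
Definition fullcolcount l c := #|[set Z : 'M[F]_(l, c) | \rank Z == c]|.

Lemma card_mx_set l k : (#|F| ^ (l * k))%N = #|[set Z : 'M[F]_(l, k) | xpredT Z]|.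
Proof. by rewrite -card_mx -cardsT; apply: eq_card => Z; rewrite !inE. Qed.

Lemma expr_mulmx_swap m n (X : 'M[F]_(m, n)) (Y : 'M_(n, m)) s :
  (X *m Y) ^+ s.+1 = X *m (Y *m X) ^+ s *m Y.
Proof.
elim: s => [|s IH]; first by rewrite expr1 expr0 mulmx1.
by rewrite exprS IH exprS -!mulmxE !mulmxA.
Qed.

Lemma expr_conjmx m (P N : 'M[F]_m) s : P \in unitmx -> N ^+ s = 0 ->
  (P *m N *m invmx P) ^+ s = 0.
Proof.
case: s => [_|s Pu N0]; first by rewrite !expr0.
rewrite -mulmxA expr_mulmx_swap mulmxKV // mulmxA -[P *m _ *m N]mulmxA.
by have := exprSr N s; rewrite N0 -mulmxE => <-; rewrite mulmx0 mul0mx.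
Qed.

Lemma mul_usubmx_inv k l (P : 'M[F]_(k + l)) : P \in unitmx ->
  usubmx P *m invmx P = row_mx 1%:M 0.
Proof.
by move=> Pu; rewrite mul_usub_mx mulmxV // scalar_mx_block block_mxEv col_mxKu.
Qed.

Lemma mul_row10 k l n (Y : 'M[F]_(k + l, n)) : row_mx 1%:M 0 *m Y = usubmx Y.
Proof. by rewrite -{1}(vsubmxK Y) mul_row_col mul1mx mul0mx addr0. Qed.

(* [Y] is the matrix of N onto its image in a basis [P] of F^(k+l) whose first
   [k] rows span the image, so [usubmx Y] is N restricted to its image. *)
Lemma card_nilpotent_step s k l :
  (GLcard F (k + l) *
    #|[set Y : 'M[F]_(k + l, k) | (usubmx Y ^+ s == 0%R) && (\rank Y == k)]| =
  (GLcard F k * (GLcard F l * #|F| ^ (l * k))) * nilrank s.+1 (k + l) k)%N.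
Proof.
rewrite /GLcard -[in LHS]card_pair_set.
rewrite card_mx_set.
rewrite -(card_pair_set [in unitmx]) -(card_pair_set [in unitmx]).
pose h (x : 'M[F]_(k + l) * 'M[F]_(k + l, k)) := invmx x.1 *m x.2 *m usubmx x.1.
(* The block lower triangular matrices are the changes of basis that keep the span of the first [k]
   rows. *)
pose act (v : 'M[F]_k * ('M[F]_l * 'M[F]_(l, k)))
    (x : 'M[F]_(k + l) * 'M[F]_(k + l, k)) :=
  let T := block_mx v.1 0 v.2.2 v.2.1 in
  (T *m x.1, T *m x.2 *m invmx v.1).
have frU (P : 'M[F]_(k + l)) : P \in unitmx -> row_free (usubmx P).
  move=> Pu; apply/row_freeP; exists (invmx P *m col_mx 1%:M 0).
  by rewrite mulmxA mul_usubmx_inv // mul_row_col mul1mx mul0mx addr0.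
have hS P Y : P \in unitmx ->
    (h (P, Y)) ^+ s.+1 = invmx P *m Y *m usubmx Y ^+ s *m usubmx P.
  move=> Pu; rewrite /h /= expr_mulmx_swap; congr (_ *m _ ^+ _ *m _).
  by rewrite mulmxA mul_usubmx_inv // mul_row10.
(* Rank [k] gives [Y] a left inverse. *)
have freeY (Y : 'M[F]_(k + l, k)) n (Z : 'M_(k, n)) :
    \rank Y = k -> Y *m Z = 0 -> Z = 0.
  move=> rk YZ; have /row_fullP[X XY] : row_full Y by apply/eqP.
  by rewrite -[Z]mul1mx -XY -mulmxA YZ mulmx0.
apply: (@card_torsor _ _ _ _ _ _ h act).
- case=> P Y; rewrite !inE => /= /and3P[Pu /eqP Y0 /eqP rk].
  rewrite hS // Y0 mulmx0 mul0mx eqxx /= /h /= mxrankMfree ?frU //.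
  by rewrite (eqmxMfull _) ?row_full_unit ?unitmx_inv // rk.
- move=> N; rewrite inE => /andP[/eqP N0 /eqP rk].
  (* Gaussian elimination writes [N] as [col_ebase N], [pid_mx k] and [row_ebase N] multiplied
     together, so only the first [k] columns of the first factor and the first [k] rows of the last
     one contribute. *)
  pose P : 'M[F]_(k + l) := row_ebase N.
  have Pu : P \in unitmx by apply: row_ebase_unit.
  pose Y := P *m lsubmx (col_ebase N : 'M_(k + l)).
  have hE : h (P, Y) = N.
    rewrite /h /= /Y mulKmx // -[RHS]mulmx_ebase rk pid_mx_block.
    rewrite -[in RHS](hsubmxK (col_ebase N : 'M_(k + l))) -/P -[in RHS](vsubmxK P).
    by rewrite block_mxEv mul_row_col row_mx0 mulmx0 addr0 -mulmxA mul_row_col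
      mul1mx mul0mx addr0.
  have rkY : \rank Y = k.
    rewrite -[RHS]rk -hE /h /= [RHS]mxrankMfree ?frU //.
    by rewrite [RHS]eqmxMfull ?row_full_unit ?unitmx_inv.
  clearbody Y; exists (P, Y) => //; rewrite !inE /= Pu rkY eqxx andbT.
  move: N0; rewrite -hE hS // -!mulmxA => /(congr1 (mulmx P)).
  rewrite mulKVmx // mulmx0 => YZ; have /eqP := freeY _ _ _ rkY YZ.
  by rewrite mulmx_free_eq0 ?frU.
- case=> R [T Z] [P Y]; rewrite !inE /= => /and3P[Ru Tu _] /and3P[Pu /eqP Y0 /eqP rk].
  set D := block_mx R 0 Z T.
  have Du : D \in unitmx by rewrite unitmx_block_lower Ru.
  have DU n (V : 'M[F]_(k + l, n)) : usubmx (D *m V) = R *m usubmx V.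
    by rewrite /D -{1}(vsubmxK V) mul_block_col mul0mx addr0 col_mxKu.
  rewrite unitmx_mul Du Pu -mul_usub_mx DU expr_conjmx // eqxx.
  rewrite mxrankMfree ?row_free_unit ?unitmx_inv //.
  rewrite (eqmxMfull _) ?row_full_unit // rk eqxx; split => //.
  rewrite /h /= DU !mulmxA mulmxKV //; congr (_ *m _ *m _).
  rewrite -[LHS](mulmxK Pu) -[_ *m D *m P]mulmxA mulVmx ?mul1mx //.
  by rewrite unitmx_mul Du.
- case=> P Y; rewrite !inE /= => /and3P[Pu _ _] [R [T Z]] [R' [T' Z']] _ _ [+ _].
  move/(congr1 (mulmx^~ (invmx P))); rewrite !mulmxK // => /eq_block_mx.
  by case=> -> _ -> ->.
- case=> P Y [P' Y']; rewrite !inE /h /=.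
  case/and3P=> Pu /eqP Y0 /eqP rk /and3P[Pu' /eqP Y0' /eqP rk'] E.
  pose T := P' *m invmx P.
  have Tu : T \in unitmx by rewrite unitmx_mul Pu' unitmx_inv.
  have TE : row_mx (T *m Y) 0 = Y' *m usubmx T.
    rewrite /T -mul_usub_mx mulmxA.
    have -> : Y' *m usubmx P' = P' *m (invmx P *m Y *m usubmx P).
      by rewrite E -mulmxA mulKVmx.
    rewrite -!mulmxA mul_usubmx_inv // !mulmxA mul_mx_row mulmx1 mulmx0.
    by [].
  move: TE; rewrite -[usubmx T]hsubmxK mul_mx_row => /eq_row_mx[T1 /esym T2].
  (* The first [k] rows of [P] and of [P'] span the same image, so [T] is block lower triangular. *)
  have {}T2 : ursubmx T = 0 by apply: freeY rk' T2.
  have TB : T = block_mx (ulsubmx T) 0 (dlsubmx T) (drsubmx T) by rewrite -T2 submxK.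
  move: (Tu); rewrite TB unitmx_block_lower => /andP[u1 u2].
  exists (ulsubmx T, (drsubmx T, dlsubmx T)); first by rewrite !inE /= u1 u2.
  by rewrite /act /= -TB T1 /T mulmxKV // mulmxK.
Qed.

(** In the basis [V] the row space of [B] is that of the first [j] coordinates. The first [j]
    columns of the new rows are then free, and the last [c] columns must have rank [c]. *)
Lemma card_extend_rank j c l (B : 'M[F]_(j + c)) : \rank B = j ->
  #|[set C : 'M[F]_(l, j + c) | \rank (col_mx B C) == (j + c)%N]| =
  (#|F| ^ (l * j) * fullcolcount l c)%N.
Proof.
move=> rk; pose V : 'M[F]_(j + c) := row_ebase B.
have Vu : V \in unitmx by apply: row_ebase_unit.
have rkE (C1 : 'M[F]_(l, j)) (C2 : 'M[F]_(l, c)) :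
    \rank (col_mx B (row_mx C1 C2 *m V)) = (j + \rank C2)%N.
  rewrite -[B]mulmx_ebase rk -/V -mul_col_mx mxrankMfree ?row_free_unit //.
  set L := col_ebase B; have Lu : L \in unitmx by apply: col_ebase_unit.
  transitivity (\rank (block_mx (1%:M : 'M[F]_j) 0 C1 C2)).
    rewrite block_mxEv -!addsmxE.
    have E : (L *m pid_mx j :=: row_mx (1%:M : 'M[F]_j) (0 : 'M_(j, c)))%MS.
      apply: eqmx_trans (eqmxMfull _ _) _; first by rewrite row_full_unit.
      rewrite pid_mx_block block_mxEv row_mx0; exact: eqmx_trans (eqmx_sym (addsmxE _ _)) (addsmx0 _ _).
    by rewrite (adds_eqmx E (eqmx_refl _)).
  have -> : block_mx (1%:M : 'M[F]_j) 0 C1 C2 =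
      block_mx 1%:M 0 C1 1%:M *m block_mx 1%:M 0 0 C2.
    by rewrite mulmx_block !mulmx1 !mul1mx !mulmx0 !mul0mx !addr0 !add0r.
  rewrite (eqmxMfull _) ?rank_diag_block_mx ?mxrank1 //.
  by rewrite row_full_unit unitmx_block_lower !unitmx1.
pose X := [set x : 'M[F]_(l, j) * 'M[F]_(l, c) | xpredT x.1 && (\rank x.2 == c)].
have -> : (#|F| ^ (l * j) * fullcolcount l c)%N = #|X|.
  by rewrite [RHS](card_pair_set xpredT (fun Z => \rank Z == c)) card_mx_set.
rewrite -(@card_imset _ _ (fun x => row_mx x.1 x.2 *m V)); last first.
  case=> x1 x2 [y1 y2] /= /(congr1 (mulmx^~ (invmx V))); rewrite !mulmxK //.
  by case/eq_row_mx=> -> ->.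
apply: eq_card => C; rewrite inE; apply/idP/imsetP => [rC|[[C1 C2]]]; last first.
  by rewrite inE /= => /eqP rC ->; rewrite rkE rC.
have CE : C = row_mx (lsubmx (C *m invmx V)) (rsubmx (C *m invmx V)) *m V.
  by rewrite hsubmxK mulmxKV.
exists (lsubmx (C *m invmx V), rsubmx (C *m invmx V)) => //.
by rewrite inE /= -(eqn_add2l j) -(rkE (lsubmx (C *m invmx V))) -CE.
Qed.

(** An invertible matrix restricts to its first [c] columns, which are independent. Two completions
    of the same columns differ by right multiplication by a block upper triangular matrix with
    identity corner. *)
Lemma card_full_columns c d :
  (GLcard F (c + d) =
    #|F| ^ (c * d) * GLcard F d * fullcolcount (c + d) c)%N.
Proof.
rewrite {2}/GLcard.
rewrite card_mx_set.
rewrite -(card_pair_set _ [in unitmx]).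
pose act (v : 'M[F]_(c, d) * 'M[F]_d) (P : 'M[F]_(c + d)) :=
  P *m block_mx 1%:M v.1 0 v.2.
have lE (P : 'M[F]_(c + d)) : lsubmx P = P *m col_mx 1%:M 0.
  by rewrite -{2}(hsubmxK P) mul_row_col mulmx1 mulmx0 addr0.
apply: (@card_torsor _ _ _ _ _ _ (@lsubmx _ _ _ _) act).
- move=> P; rewrite !inE => Pu; rewrite lE (eqmxMfull _) ?row_full_unit //.
  by rewrite rank_col_mx0 mxrank1.
- move=> Z; rewrite inE => /eqP rk.
  pose L : 'M[F]_(c + d) := col_ebase Z.
  exists (L *m block_mx (row_ebase Z) 0 0 1%:M).
    by rewrite inE unitmx_mul col_ebase_unit unitmx_block_lower row_ebase_unit unitmx1.
  rewrite lE -mulmxA mul_block_col !mul0mx !mulmx0 !addr0 mulmx1.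
  rewrite -[RHS]mulmx_ebase rk pid_mx_col -!mulmxA mul_col_mx mul1mx mul0mx.
  by [].
- case=> X T P; rewrite !inE /= => Tu Pu.
  split; last by rewrite !lE -mulmxA mul_block_col !mulmx1 !mulmx0 !addr0.
  by rewrite unitmx_mul Pu unitmxE det_ublock det1 mul1r.
- move=> P; rewrite inE => Pu [X T] [X' T'] _ _.
  by move/(congr1 (mulmx (invmx P))); rewrite /act /= !mulKmx // => /eq_block_mx[_ -> _ ->].
- move=> P P'; rewrite !inE => Pu Pu' E.
  pose T := invmx P *m P'.
  have TE : T *m col_mx 1%:M 0 = col_mx 1%:M 0.
    by rewrite /T -mulmxA -lE -E lE mulKmx.
  have Tu : T \in unitmx by rewrite unitmx_mul unitmx_inv Pu.
  move: TE; rewrite -lE -{1}[T]submxK block_mxEh row_mxKl => /eq_col_mx[T1 T2].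
  have TB : T = block_mx 1%:M (ursubmx T) 0 (drsubmx T).
    by rewrite -[X in block_mx X]T1 -[X in block_mx _ _ X]T2 submxK.
  exists (ursubmx T, drsubmx T); last by rewrite /act /= -TB /T mulKVmx.
  rewrite inE /= unitmxE; have : \det T \is a GRing.unit by rewrite -unitmxE.
  by rewrite {1}TB det_ublock det1 mul1r.
Qed.

Let q : rat := #|F|%:R.
(** The q-Pochhammer symbol (1/q; 1/q)_a. *)
Definition qfact (q : rat) a : rat := \prod_(1 <= j < a.+1) (1 - (q ^+ j)^-1).

Lemma card_field_neq0 : q != 0.
Proof. by rewrite pnatr_eq0 -lt0n (ltn_trans _ (finNzRing_gt1 F)). Qed.

(** A factor q^i is taken out of each q^i - 1 in the usual order formula; together with q^C(n,2)
    these powers multiply to q^(n^2). *)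
Lemma GLcardE n : (GLcard F n)%:R = q ^+ (n ^ 2) * qfact q n.
Proof.
have q0 := card_field_neq0.
have -> : GLcard F n = (#|F| ^ 'C(n, 2) * \prod_(1 <= i < n.+1) (#|F| ^ i - 1))%N.
  case: n => [|n].
    rewrite /GLcard big_geq // (@eq_card1 _ (0 : 'M_0)) // => A.
    by rewrite !inE unitmxE det_mx00 unitr1; apply/esym/eqP/matrixP => -[].
  by rewrite -card_GL // cardsT /= card_sub; apply: eq_card => A; rewrite !inE.
rewrite natrM natrX -/q /qfact.
elim: n => [|n IH]; first by rewrite !big_geq.
rewrite !(@big_nat_recr _ _ _ n.+1) //= natrM binS bin1 exprD.
have -> : (#|F| ^ n.+1 - 1)%:R = q ^+ n.+1 * (1 - (q ^+ n.+1)^-1).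
  rewrite mulrBr mulr1 divff ?expf_neq0 // natrB ?natrX //.
  by rewrite expn_gt0 (ltn_trans _ (finNzRing_gt1 F)).
have -> : (n.+1 ^ 2 = n ^ 2 + (n + n.+1))%N by rewrite -addn1 sqrnD; lia.
rewrite !exprD mulrACA IH; ring.
Qed.

(* The image of N has dimension [m - a]; truncation makes the test [a <= m]
   necessary. *)
Definition nilcorank s a m : rat :=
  if (a <= m)%N then (nilrank s m (m - a)%N)%:R / (GLcard F m)%:R else 0.

Lemma qfact_neq0 n : qfact q n != 0.
Proof. by have := GLcard_neq0 F n; rewrite GLcardE mulf_eq0 => /norP[]. Qed.

Lemma nilcount_corank s m :
  (nilcount s m)%:R / (GLcard F m)%:R = \sum_(a < m.+1) nilcorank s a m.
Proof.
rewrite (reindex_inj rev_ord_inj) /=.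
have -> : nilcount s m = (\sum_(k < m.+1) nilrank s m k)%N.
  rewrite /nilcount -sum1_card.
  rewrite (partition_big (fun A => inord (\rank A) : 'I_m.+1) xpredT) //=.
  apply: eq_bigr => i _; rewrite /nilrank -sum1_card; apply: eq_bigl => A.
  rewrite !inE; congr andb.
  by rewrite -val_eqE /= inordK ?ltnS ?rank_leq_row.
rewrite natr_sum mulr_suml; apply: eq_bigr => i _.
by rewrite /nilcorank subSS leq_subr subKn // -ltnS.
Qed.

(** Fix the upper square block, of corank [c]; the [l] rows below must raise the rank to [k], and
    [card_extend_rank] counts them. *)
Lemma card_corner s k l :
  #|[set Y : 'M[F]_(k + l, k) | (usubmx Y ^+ s == 0%R) && (\rank Y == k)]| =
  (\sum_(c < k.+1) nilrank s k (k - c) *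
     (#|F| ^ (l * (k - c)) * fullcolcount l c))%N.
Proof.
rewrite (reindex_inj rev_ord_inj) /=.
rewrite -sum1_card.
rewrite (partition_big (fun Y : 'M[F]_(k + l, k) =>
  inord (\rank (usubmx Y)) : 'I_k.+1) xpredT) //=.
apply: eq_bigr => i _; rewrite subSS.
rewrite (eq_bigl (fun Y : 'M[F]_(k + l, k) => [&& usubmx Y ^+ s == 0%R,
  \rank Y == k & \rank (usubmx Y) == i])); last first.
  move=> Y; rewrite !inE -andbA; congr [&& _, _ & _].
  by rewrite -val_eqE /= inordK ?ltnS ?rank_leq_row.
case: i => i /=; rewrite ltnS => le_ik; have := subnKC le_ik; rewrite subKn //.
move: (k - i)%N => c kE; case: k / kE {le_ik}.
rewrite (partition_big (fun Y : 'M[F]_(i + c + l, i + c) => usubmx Y)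
  (fun N : 'M[F]_(i + c) => (N ^+ s == 0%R) && (\rank N == i))) /=; last first.
  by move=> Y /and3P[-> _ ->].
rewrite -sum_nat_const; apply: eq_big => [B|B /andP[B0 /eqP rk]].
  by rewrite inE.
rewrite -(card_extend_rank l rk).
rewrite -(card_imset _ (f := col_mx B)); last first.
  by move=> C C' /eq_col_mx[].
rewrite -sum1_card; apply: eq_bigl => Y.
apply/idP/imsetP => [/andP[/and3P[_ rY _] /eqP <-]|[C]].
  by exists (dsubmx Y); rewrite ?inE vsubmxK.
by rewrite inE => rC ->; rewrite col_mxKu B0 rC rk !eqxx.
Qed.

(** This combines [card_nilpotent_step] for an image of dimension [m - a] with [card_corner], where
    [c] is the corank of the restriction of [N] to its image. The rest is cancellation of group
    orders. *)
Lemma nilcorank_rec s a m : (a <= m)%N ->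
  nilcorank s.+1 a m =
  (q ^+ (a ^ 2))^-1 * \sum_(c < a.+1) nilcorank s c (m - a)%N / qfact q (a - c)%N.
Proof.
move=> le_am; rewrite /nilcorank le_am.
have: (m - a + a = m)%N by rewrite subnK.
move: (m - a)%N => k <- {m le_am}; have q0 := card_field_neq0.
have := card_nilpotent_step s k a; rewrite card_corner.
move/(congr1 (fun x => x%:R : rat)); rewrite !natrM natr_sum natrX -/q => E.
have {E} -> : (nilrank s.+1 (k + a) k)%:R / (GLcard F (k + a))%:R =
  (\sum_(c < k.+1)
    (nilrank s k (k - c) * (#|F| ^ (a * (k - c)) * fullcolcount a c))%N%:R)
  / ((GLcard F k)%:R * ((GLcard F a)%:R * q ^+ (a * k))).
  apply/eqP; rewrite eqr_div ?mulf_neq0 ?expf_neq0 ?GLcard_neq0 //; apply/eqP.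
  by rewrite mulrC -E mulrC.
rewrite mulr_suml mulr_sumr.
(* The counting yields a sum over [c <= k], the claim a sum over [c <= a]. Extending the summand by
   zero beyond either bound makes the two comparable. *)
pose f c : rat := if (c <= k)%N && (c <= a)%N then
    (q ^+ (a ^ 2))^-1 *
    ((nilrank s k (k - c)%N)%:R / (GLcard F k)%:R / qfact q (a - c)%N)
  else 0.
have fE (n n' : nat) : (forall c : nat, (c < n')%N -> ~~ (c < n)%N -> f c = 0) ->
    \sum_(c < n) f c = \sum_(c < maxn n n') f c.
  move=> H; rewrite -!(big_mkord xpredT) [RHS](@big_cat_nat _ _ _ n) ?leq_maxl //=.
  rewrite [X in _ = _ + X]big_nat_cond [X in _ = _ + X]big1 ?addr0 // => c.
  rewrite andbT => /andP[nc]; rewrite leq_max ltnNge nc /= => cn.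
  by apply: H; rewrite -?leqNgt.
transitivity (\sum_(c < k.+1) f c); last first.
  transitivity (\sum_(c < a.+1) f c).
    rewrite (fE _ a.+1) 1?[RHS](fE _ k.+1) 1?maxnC // => c cn.
    - by rewrite -leqNgt /f => /ltn_geF->; rewrite ?andbF.
    - by rewrite -leqNgt /f => /ltn_geF->; rewrite ?andbF.
  apply: eq_bigr => -[c /=]; rewrite ltnS /f => -> _; rewrite andbT.
  by case: ifP => _ //; rewrite mul0r mulr0.
apply: eq_bigr => -[c /=]; rewrite ltnS /f => ck _; rewrite ck /=.
have [ca|ac] := leqP c a; last first.
  (* Columns of height [a] cannot be independent when there are [c > a] of them. *)
  suff -> : fullcolcount a c = 0%N by rewrite !muln0 mul0r.
  apply/eqP; rewrite cards_eq0; apply/eqP/setP => Z; rewrite !inE.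
  by apply/negP => /eqP rk; have := rank_leq_row Z; rewrite rk leqNgt ac.
have := card_full_columns c (a - c); rewrite subnKC // => /(congr1 (fun x => x%:R : rat)).
rewrite !natrM !natrX -/q => E.
have G := GLcard_neq0 F (a - c)%N.
have -> : (fullcolcount a c)%:R =
    (GLcard F a)%:R / (q ^+ (c * (a - c)) * (GLcard F (a - c))%:R).
  by rewrite E mulrC mulKf // mulf_neq0 ?expf_neq0.
have GE := GLcardE (a - c); have W := qfact_neq0 (a - c).
rewrite GE.
have -> : q ^+ (a * k) = q ^+ (a * (k - c)) * q ^+ (a * c).
  by rewrite -exprD -mulnDr subnK.
(* The exponents satisfy a^2 = a c + c (a - c) + (a - c)^2. *)
have -> : q ^+ (a ^ 2) = q ^+ (a * c) * q ^+ (c * (a - c)) * q ^+ ((a - c) ^ 2).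
  rewrite -!exprD; congr (_ ^+ _); rewrite -{1}(subnK ca) -{2}(subnK ca).
  by rewrite -mulnn; move: (a - c)%N => d; lia.
by field; rewrite !expf_neq0 ?W ?GLcard_neq0.
Qed.

(** The identity vanishes only in dimension 0, so the zeroth power leaves just the empty matrix. *)
Lemma nilcorank0 a m : nilcorank 0 a m = ((a == 0%N) && (m == 0%N))%:R.
Proof.
rewrite /nilcorank /nilrank; case: m => [|m].
  rewrite leqn0 andbT; case: eqP => // ->.
  rewrite (_ : [set _ | _] = [set 0]); last first.
    apply/setP => N; rewrite !inE; have -> : N = 0 by apply/matrixP => -[].
    by rewrite mxrank0 expr0 !eqxx andbT; apply/eqP/matrixP => -[].
  rewrite cards1 /GLcard (@eq_card1 _ (0 : 'M_0)) ?divr1 // => A.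
  by rewrite !inE unitmxE det_mx00 unitr1; apply/esym/eqP/matrixP => -[].
rewrite andbF; case: ifP => // _.
rewrite (_ : [set _ | _] = set0) ?cards0 ?mul0r //; apply/setP => N.
by rewrite !inE expr0 oner_eq0.
Qed.

End Nilpotent.

(** * Partitions *)

Section PartitionLists.

(** Partitions without the zero padding of [is_partition_code], a form in which columns of the
    diagram can be added and removed. *)
Definition is_parts m (l : seq nat) :=
  [&& sorted geq l, all (leq 1) l & sumn l == m].

Lemma leq_sumn (l : seq nat) y : y \in l -> (y <= sumn l)%N.
Proof. by elim: l => //= z l IH; rewrite inE => /predU1P[->|/IH]; lia. Qed.

Lemma size_leq_sumn (l : seq nat) : all (leq 1) l -> (size l <= sumn l)%N.
Proof. by elim: l => //= y l IH /andP[y0 /IH]; lia. Qed.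

Lemma geq_transitive : transitive geq.
Proof. by move=> y x z /= yx zy; apply: leq_trans zy yx. Qed.

(** The zeros of a nonincreasing list sit at its end, where the default value 0 of [nth] stands in
    for them. *)
Lemma nth_filter_pos l i : sorted geq l ->
  nth 0%N [seq x <- l | (0 < x)%N] i = nth 0%N l i.
Proof.
elim: l i => //= x l IH i; rewrite (path_sortedE geq_transitive) => /andP[lex sl].
case: x lex => [|x] lex /=; last by case: i => //= i; apply: IH.
have l0 y : y \in l -> y = 0%N by move=> /(allP lex) /=; rewrite leqn0 => /eqP.
have -> : [seq x <- l | (0 < x)%N] = [::].
  apply/eqP; rewrite -size_eq0 size_filter eqn0Ngt -has_count.
  by apply/hasPn => y /l0 ->.
rewrite nth_nil; case: i => //= i; have [il|il] := ltnP i (size l).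
  by rewrite (l0 _ (mem_nth 0%N il)).
by rewrite nth_default.
Qed.

Lemma filter_pos_nseq0 k : [seq x <- nseq k 0%N | (0 < x)%N] = [::].
Proof. by elim: k. Qed.

Lemma sumn_filter_pos l : sumn [seq x <- l | (0 < x)%N] = sumn l.
Proof. by elim: l => //= -[|x] l /= ->. Qed.

(** * Partition codes correspond to lists of positive parts *)

Section Codes.
Variable m : nat.
Implicit Type f : {ffun 'I_m -> 'I_m.+1}.

Let vals f := [seq (f i : nat) | i <- enum 'I_m].

Lemma nth_vals f (i : 'I_m) : nth 0%N (vals f) i = f i.
Proof. by rewrite (nth_map i) ?nth_ord_enum ?size_enum_ord. Qed.

Lemma vals_sorted f : is_partition_code f -> sorted geq (vals f).
Proof.
case/andP=> /forallP mono _; apply/(sortedP 0%N) => i.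
rewrite size_map size_enum_ord => lt_im.
have im := ltn_trans (ltnSn i) lt_im.
rewrite (nth_vals f (Ordinal im)) (nth_vals f (Ordinal lt_im)).
have /forallP/(_ (Ordinal lt_im)) /= := mono (Ordinal im).
by rewrite leqnSn.
Qed.

Lemma sumn_vals f : sumn (vals f) = (\sum_(i < m) f i)%N.
Proof. by rewrite sumnE big_map big_enum. Qed.

Lemma parts_inj : {in @is_partition_code m &, injective (@parts m)}.
Proof.
move=> f g /vals_sorted sf /vals_sorted sg fg; apply/ffunP => i; apply: val_inj.
by rewrite /= -!nth_vals -(nth_filter_pos i sf) -(nth_filter_pos i sg) -/(parts f) fg.
Qed.

(** A list is padded back with zeros to length [m]: its parts being positive, there are at most [m]
    of them, and each is at most the sum [m]. *)
Lemma partsP l : reflect (exists2 f : {ffun 'I_m -> 'I_m.+1}, is_partition_code f & l = parts f)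
  (is_parts m l).
Proof.
apply: (iffP and3P) => [[sl pl /eqP sum]|[f cf ->]]; last first.
  split.
  - exact: sorted_filter geq_transitive _ _ (vals_sorted cf).
  - by rewrite filter_all.
  - by rewrite sumn_filter_pos sumn_vals; case/andP: cf.
have sz : (size l <= m)%N by rewrite -sum size_leq_sumn.
have le_m i : (nth 0%N l i < m.+1)%N.
  rewrite ltnS; have [il|il] := ltnP i (size l); last by rewrite nth_default.
  by rewrite -[leqRHS]sum leq_sumn // mem_nth.
pose f : {ffun 'I_m -> 'I_m.+1} := [ffun i : 'I_m => Ordinal (le_m i)].
have fE : vals f = l ++ nseq (m - size l) 0%N.
  apply: (@eq_from_nth _ 0%N) => [|i].
    by rewrite size_map size_enum_ord size_cat size_nseq subnKC.
  rewrite size_map size_enum_ord => im.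
  rewrite (nth_vals f (Ordinal im)) ffunE /= nth_cat; case: ltnP => // il.
  by rewrite nth_nseq if_same nth_default.
exists f; last first.
  rewrite /parts -/(vals f) fE filter_cat.
  rewrite filter_pos_nseq0.
  by rewrite cats0; apply/esym/all_filterP.
apply/andP; split; last first.
  by rewrite -sumn_vals fE sumn_cat sumn_nseq mul0n addn0 sum.
apply/'forall_forallP => i j; apply/implyP => ij; rewrite !ffunE /=.
have [jl|jl] := ltnP j (size l); last by rewrite [leqLHS]nth_default.
have il : (i < size l)%N by apply: leq_ltn_trans jl.
exact: (sorted_leq_nth geq_transitive leqnn 0%N sl).
Qed.

Definition plist := [seq parts f | f <- enum (@is_partition_code m)].

Lemma plist_uniq : uniq plist.
Proof.
rewrite map_inj_in_uniq ?enum_uniq // => f g; rewrite !mem_enum.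
exact: parts_inj.
Qed.

Lemma mem_plist l : (l \in plist) = is_parts m l.
Proof.
apply/mapP/partsP => [[f]|[f]]; first by rewrite mem_enum; exists f.
by exists f; rewrite ?mem_enum.
Qed.

End Codes.

Lemma parts_size m l : is_parts m l -> (size l <= m)%N.
Proof. by case/and3P=> _ pl /eqP<-; apply: size_leq_sumn. Qed.

(** For [size l <= a], a column of length [a] is glued to the left of the Young diagram; the
    appended ones are the rows that were empty before. *)
Definition add_column a (l : seq nat) := map succn l ++ nseq (a - size l) 1%N.
Definition remove_column (l : seq nat) := [seq x <- map predn l | (0 < x)%N].

Lemma add_columnK a l : all (leq 1) l -> remove_column (add_column a l) = l.
Proof.
move=> pl; rewrite /remove_column /add_column map_cat filter_cat -map_comp.
rewrite (eq_map (g := id)) // map_id map_nseq.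
rewrite filter_pos_nseq0.
by rewrite cats0; apply/all_filterP.
Qed.

Lemma remove_columnK l : sorted geq l -> all (leq 1) l ->
  add_column (size l) (remove_column l) = l.
Proof.
elim: l => //= x l IH; rewrite (path_sortedE geq_transitive) => /andP[lex sl].
case/andP=> x0 pl; have := IH sl pl; rewrite /add_column /remove_column /=.
case: x x0 lex => // -[|x] _ lex /= E; last first.
  by rewrite subSS; congr cons.
(* A largest part equal to 1 forces all the others to be 1, so removing the column empties the
   diagram. *)
have l1 y : y \in l -> y = 1%N.
  by move=> yl; have /= := allP lex _ yl; have /= := allP pl _ yl; lia.
have -> : [seq x <- [seq x.-1 | x <- l] | (0 < x)%N] = [::].
  apply/eqP; rewrite -size_eq0 size_filter eqn0Ngt -has_count.
  by apply/hasPn => y /mapP[z /l1 -> ->].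
by rewrite /=; congr cons; apply/esym/all_pred1P/allP => y /l1 /= ->.
Qed.

Lemma sumn_succ l : sumn (map succn l) = (sumn l + size l)%N.
Proof. by elim: l => //= x l ->; lia. Qed.

Lemma lam1_le l s : sorted geq l -> (lam1 l <= s)%N = all (geq s) l.
Proof.
case: l => [|x l]; rewrite /lam1 //= (path_sortedE geq_transitive) => /andP[lex _].
apply/idP/andP => [xs|[]//]; split => //; apply/allP => y /(allP lex) /= yx.
exact: leq_trans xs.
Qed.

Lemma is_parts_add m a s l : (size l <= a <= m)%N ->
  is_parts (m - a)%N l -> (lam1 l <= s)%N ->
  [/\ is_parts m (add_column a l), (lam1 (add_column a l) <= s.+1)%N &
    size (add_column a l) = a].
Proof.
case/andP=> sa am /and3P[sl pl /eqP sum] ls.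
have srt : sorted geq (add_column a l).
  rewrite /add_column sorted_pairwise; last exact: geq_transitive.
  rewrite pairwise_cat -!(sorted_pairwise geq_transitive).
  apply/and3P; split.
  - by apply/allrelP => x y /mapP[z _ ->]; rewrite mem_nseq => /andP[_ /eqP->].
  - by rewrite sorted_map; apply: sub_sorted sl.
  - by elim: (a - size l)%N => //= n IH; case: n IH => //= n ->.
split; last by rewrite size_cat size_map size_nseq subnKC.
  apply/and3P; split => //.
    by rewrite all_cat all_nseq orbT andbT; apply/allP => y /mapP[z _ ->].
  by rewrite sumn_cat sumn_succ sumn_nseq sum; apply/eqP; lia.
rewrite lam1_le // all_cat all_nseq /= orbT andbT all_map.
by rewrite lam1_le // in ls.
Qed.

Lemma is_parts_remove m s l :
  is_parts m l -> (lam1 l <= s.+1)%N ->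
  [/\ is_parts (m - size l)%N (remove_column l), (lam1 (remove_column l) <= s)%N &
    (size (remove_column l) <= size l)%N].
Proof.
move=> pm; have := pm => /and3P[sl pl /eqP sum] ls.
have srt : sorted geq (remove_column l).
  apply: sorted_filter; first exact: geq_transitive.
  by rewrite sorted_map; apply: sub_sorted sl => x y /=; lia.
split.
- apply/and3P; split=> //; first exact: filter_all.
  rewrite /remove_column sumn_filter_pos -sum.
  apply/eqP; elim: (l) pl => //= x k IH /andP[x0 pk].
  by have := size_leq_sumn pk; rewrite IH //; lia.
- rewrite lam1_le //; apply/allP => y; rewrite mem_filter => /andP[_ /mapP[z zl ->]].
  move: ls; rewrite lam1_le // => /allP/(_ z zl) /=; lia.
- by rewrite size_filter (leq_trans (count_size _ _)) ?size_map.
Qed.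

(** Deleting the first column, of length [a], is a bijection: it removes [a] boxes, lowers the
    largest part by one and leaves at most [a] rows. *)
Lemma perm_add_column m a s : (a <= m)%N ->
  perm_eq [seq l <- plist m | (lam1 l <= s.+1)%N && (size l == a)]
    [seq add_column a l |
       l <- [seq l <- plist (m - a)%N | (lam1 l <= s)%N && (size l <= a)%N]].
Proof.
move=> am; apply: uniq_perm.
- by rewrite filter_uniq ?plist_uniq.
- rewrite map_inj_in_uniq ?filter_uniq ?plist_uniq // => l l'.
  rewrite !mem_filter !mem_plist => /andP[_ /and3P[_ pl _]] /andP[_ /and3P[_ pl' _]].
  by move=> E; rewrite -(add_columnK a pl) E add_columnK.
move=> l; apply/idP/mapP => [|[l']]; rewrite mem_filter mem_plist.
  case/andP=> /andP[ls /eqP <-] pl; exists (remove_column l).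
    by rewrite mem_filter mem_plist; have [-> -> ->] := is_parts_remove pl ls.
  by case/and3P: pl => sl pl _; rewrite remove_columnK.
case/andP=> /andP[ls sa] pl ->.
rewrite mem_filter mem_plist.
by have [|-> -> ->] := @is_parts_add m a s l' _ pl ls; rewrite ?sa ?eqxx.
Qed.

(** * Weights of partitions and their recurrence *)

Section Weights.
Variable x : rat.

(** The summand of the theorem at x = q^e with its sum and product cut at [N]. The free cut-off lets
    ranges be aligned; every [N] from [sumn l] on gives the same value. *)
Definition pweight N (l : seq nat) : rat :=
  (x ^+ (\sum_(1 <= i < N.+1) (conjp l i) ^ 2)%N *
   \prod_(1 <= i < N.+1) qfact x (multp l i))^-1.

Lemma pweight_widen N l : (sumn l <= N)%N -> pweight N l = pweight (sumn l) l.
Proof.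
move=> /subnKC<-; elim: (N - sumn l)%N => [|n IH]; first by rewrite addn0.
rewrite -{}IH /pweight addnS !(@big_nat_recr _ _ _ (sumn l + n).+1) //=.
have gt i : i \in l -> (i < (sumn l + n).+1)%N by move/leq_sumn; lia.
have -> : conjp l (sumn l + n).+1 = 0%N.
  apply/eqP; rewrite /conjp eqn0Ngt -has_count; apply/hasPn => y /gt.
  by rewrite -leqNgt; lia.
have -> : multp l (sumn l + n).+1 = 0%N.
  by apply/eqP; rewrite /multp eqn0Ngt -has_count; apply/hasPn => y /gt /=; lia.
by rewrite addn0 /qfact [X in _ * (_ * X)]big_geq ?mulr1.
Qed.

(** The new first column has length [a] and creates [a - size l] parts equal to 1; all other column
    lengths and multiplicities are those of [l] with the index shifted by one. *)
Lemma pweight_add_column a l : all (leq 1) l -> (size l <= a)%N ->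
  pweight (sumn (add_column a l)) (add_column a l) =
  (x ^+ (a ^ 2))^-1 * (pweight (sumn l) l / qfact x (a - size l)%N).
Proof.
move=> pl sa; set k := add_column a l.
have sk : sumn k = (sumn l + a)%N.
  by rewrite /k /add_column sumn_cat sumn_succ sumn_nseq; lia.
(* The cut-offs differ by one, so that the ranges agree once the term of index 1 is split off on the
   side of [k]. *)
rewrite -(@pweight_widen (sumn k).+1) // -(@pweight_widen (sumn k) l); last by lia.
have sumS (f : nat -> nat) N :
    (\sum_(1 <= i < N.+2) f i = f 1 + \sum_(1 <= i < N.+1) f i.+1)%N.
  by rewrite big_ltn // big_add1.
have prodS (f : nat -> rat) N :
    \prod_(1 <= i < N.+2) f i = f 1%N * \prod_(1 <= i < N.+1) f i.+1.
  by rewrite big_ltn // big_add1.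
rewrite /pweight sumS prodS.
have c1 : conjp k 1 = a.
  rewrite /conjp /k /add_column count_cat count_map count_nseq.
  by rewrite (@eq_count _ _ xpredT) // count_predT /= mul1n subnKC.
have cS i : (0 < i)%N -> conjp k i.+1 = conjp l i.
  move=> i0; rewrite /conjp /k /add_column count_cat count_map count_nseq.
  by rewrite ltnS leqNgt i0 mul0n addn0; apply: eq_count.
have m1 : multp k 1 = (a - size l)%N.
  rewrite /multp /k /add_column count_cat count_map count_nseq /= mul1n.
  rewrite (_ : count _ l = 0%N) //; apply/eqP; rewrite eqn0Ngt -has_count.
  by apply/hasPn => y /(allP pl) /=; lia.
have mS i : (0 < i)%N -> multp k i.+1 = multp l i.
  move=> i0; rewrite /multp /k /add_column count_cat count_map count_nseq /=.
  by rewrite [_ == i.+1]eqSS eq_sym eqn0Ngt i0 mul0n addn0; apply: eq_count.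
rewrite c1 m1.
rewrite (@eq_big_nat _ _ _ 1 _ (fun i => conjp k i.+1 ^ 2)%N (fun i => conjp l i ^ 2)%N);
  last by move=> i /andP[/cS->].
rewrite (@eq_big_nat _ _ _ 1 _ (fun i => qfact x (multp k i.+1)) (fun i => qfact x (multp l i)));
  last by move=> i /andP[/mS->].
by rewrite exprD !invfM; ring.
Qed.

(** The partition analogue of [nilcorank]: parts are Jordan block sizes, so the number of parts is
    the corank. *)
Definition pcorank s a m : rat :=
  \sum_(l <- plist m | (lam1 l <= s)%N && (size l == a)) pweight (sumn l) l.

(** Here [c] is the number of parts left after the first column is removed. The formula is that of
    [nilcorank_rec] with [x] for the field size. *)
Lemma pcorank_rec s a m : (a <= m)%N ->
  pcorank s.+1 a m =
  (x ^+ (a ^ 2))^-1 * \sum_(c < a.+1) pcorank s c (m - a)%N / qfact x (a - c)%N.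
Proof.
move=> am; rewrite /pcorank -big_filter (perm_big _ (perm_add_column s am)) /=.
rewrite big_map big_filter.
rewrite (partition_big (fun l => inord (size l) : 'I_a.+1) xpredT) //= mulr_sumr.
apply: eq_bigr => c _; rewrite mulr_suml mulr_sumr [LHS]big_seq_cond [RHS]big_seq_cond.
apply: eq_big => l; rewrite mem_plist.
  rewrite -andbA; congr (_ && (_ && _)).
  have [sa|sa] := leqP (size l) a; first by rewrite -val_eqE /= inordK.
  by apply/esym/eqP => E; have := ltn_ord c; rewrite -E ltnS leqNgt sa.
case/and3P=> /and3P[_ pl _] /andP[_ sa] /eqP <-.
by rewrite inordK // pweight_add_column.
Qed.

Lemma pcorank_gt s a m : (m < a)%N -> pcorank s a m = 0.
Proof.
move=> ma; rewrite /pcorank big_seq_cond big_pred0 // => l; rewrite mem_plist.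
by apply/negP => /and3P[/parts_size sl _ /eqP E]; move: ma; rewrite -E ltnNge sl.
Qed.

Lemma pcorank0 a m : pcorank 0 a m = ((a == 0%N) && (m == 0%N))%:R.
Proof.
have lam0 l k : is_parts k l -> (lam1 l <= 0)%N -> l = [::].
  by case: l => [|y l] //= /and3P[_ /andP[+ _] _]; rewrite /lam1 /=; case: y.
rewrite /pcorank; have [/andP[/eqP-> /eqP->]|H] := boolP ((a == 0%N) && (m == 0%N)).
  rewrite -big_filter (perm_big [:: [::]]) /=; last first.
    apply: uniq_perm; rewrite ?filter_uniq ?plist_uniq // => l.
    rewrite mem_filter mem_plist inE; apply/idP/eqP => [|-> //].
    by case/andP=> /andP[l0 _] /lam0->.
  by rewrite big_seq1 /pweight /= !big_geq // expr0 mulr1 invr1.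
rewrite big_seq_cond big_pred0 // => l; rewrite mem_plist.
apply/negP => /and3P[pl l0 /eqP sa]; have lE := lam0 _ _ pl l0.
by move: pl H; rewrite -sa lE => /and3P[_ _ /eqP <-].
Qed.

End Weights.

Lemma part_termE q e l : part_term q e l = pweight (q%:R ^+ e) (sumn l) l.
Proof.
rewrite /part_term /pweight exprM; congr (_ * _)^-1.
by apply: eq_bigr => i _; apply: eq_bigr => j _; rewrite exprM.
Qed.

Lemma sum_part_term q e m s :
  \sum_(f : {ffun 'I_m -> 'I_m.+1} |
           is_partition_code f && (lam1 (parts f) <= s)%N) part_term q e (parts f)
  = \sum_(a < m.+1) pcorank (q%:R ^+ e) s a m.
Proof.
transitivity (\sum_(l <- plist m | (lam1 l <= s)%N) part_term q e l).
  by rewrite big_map big_enum_cond.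
rewrite big_seq_cond.
rewrite (partition_big (fun l => inord (size l) : 'I_m.+1) xpredT) //=.
apply: eq_bigr => a _; rewrite /pcorank [RHS]big_seq_cond.
apply: eq_big => l; last by rewrite part_termE.
rewrite mem_plist -andbA; case pl: (is_parts m l) => //=.
by congr (_ && _); rewrite -val_eqE /= inordK // ltnS parts_size.
Qed.

End PartitionLists.

(** Split by corank and by number of parts, the two sides obey the same recurrence in [s] with the
    same initial values, so induction on [s] matches them term by term. *)
Lemma nilpotent_partition_sum (K : finFieldType) q e m s : #|K| = (q ^ e)%N ->
  (nilcount K s m)%:R / (GLcard K m)%:R =
  \sum_(f : {ffun 'I_m -> 'I_m.+1} |
           is_partition_code f && (lam1 (parts f) <= s)%N) part_term q e (parts f).
Proof.
move=> cK; rewrite nilcount_corank sum_part_term -natrX -cK.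
apply: eq_bigr => -[a /= _] _; elim: s m a => [|s IH] m a.
  by rewrite nilcorank0 pcorank0.
have [am|ma] := leqP a m; last by rewrite pcorank_gt // /nilcorank leqNgt ma.
rewrite nilcorank_rec // pcorank_rec //; congr (_ * _).
by apply: eq_bigr => c _; rewrite IH.
Qed.

(** * Restriction of scalars along F[X]/(phi) *)

Lemma mul_rV_lin1_fun (R : pzRingType) m n (f : 'rV[R]_m -> 'rV[R]_n) :
  {morph f : u v / u + v} -> (forall a, {morph f : u / a *: u}) ->
  forall u, u *m lin1_mx f = f u.
Proof.
move=> fD fZ u.
have lin : linear f by move=> a v w; rewrite fD fZ.
pose fL : {linear 'rV[R]_m -> 'rV[R]_n} :=
  HB.pack f (GRing.isLinear.Build _ _ _ _ f lin).
exact: (mul_rV_lin1 fL u).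
Qed.

Lemma mulrV_ext (R : pzSemiRingType) m n (A B : 'M[R]_(m, n)) :
  (forall w : 'rV_m, w *m A = w *m B) -> A = B.
Proof. by move=> AB; apply/row_matrixP => i; rewrite !rowE. Qed.

Lemma peval_comp (F : fieldType) n (A : 'M[F]_n) g h :
  peval A (g \Po h) = peval (peval A h) g.
Proof.
elim/poly_ind: g => [|g c IH]; first by rewrite comp_poly0 !rmorph0.
by rewrite comp_poly_MXaddC !rmorphD !rmorphM /= IH pevalX !pevalC.
Qed.

Lemma card_pchar_nat (F : finFieldType) k : [pchar F].-nat (#|F| ^ k)%N.
Proof.
have [p p_pr pF] := finPcharP F; rewrite pnatX; apply/orP; left.
have : p.-nat #|[set: F]| := pprimeChar_pgroup pF; rewrite cardsT.
by apply: sub_in_pnat => r _ /eqP ->.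
Qed.

(** Raising to a power of [#|F|] is additive in characteristic p and fixes the coefficients. *)
Lemma poly_exp_card (F : finFieldType) (g : {poly F}) k :
  g ^+ (#|F| ^ k) = g \Po 'X^(#|F| ^ k).
Proof.
have pn := card_pchar_nat F k; elim/poly_ind: g => [|g c IH].
  by rewrite comp_poly0 expr0n expn_eq0 eqn0Ngt (ltn_trans _ (finNzRing_gt1 F)).
rewrite comp_poly_MXaddC exprDn_pchar; last first.
  by rewrite (eq_pnat _ (pchar_poly F)).
rewrite exprMn IH; congr (_ + _); rewrite -rmorphXn /=; congr polyC.
by elim: k {pn IH} => [|k IH]; rewrite ?expr1 // expnS exprM expf_card.
Qed.

(** * The field K = F[X]/(phi), with [proj] the reduction and [rep] the representative of degree
    below [e] *)

Section Extension.
Variables (F K : finFieldType) (phi : {poly F}) (e : nat).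
Variables (proj : {rmorphism {poly F} -> K}) (rep : K -> {poly F}).
Hypothesis repK : cancel rep proj.
Hypothesis size_rep : forall k, (size (rep k) <= e)%N.
Hypothesis size_phi : size phi = e.+1.
Hypothesis proj_eq0 : forall g, (proj g == 0) = (phi %| g).
Hypothesis e_gt0 : (0 < e)%N.

Lemma rep_proj (g : {poly F}) : (size g <= e)%N -> rep (proj g) = g.
Proof.
move=> sg; apply/eqP; rewrite -subr_eq0; apply/negPn/negP => nz.
have /(dvdp_leq nz) : phi %| rep (proj g) - g.
  by rewrite -proj_eq0 rmorphB repK subrr.
rewrite size_phi leqNgt ltnS (leq_trans (size_polyD _ _)) //.
by rewrite size_polyN geq_max size_rep.
Qed.

Lemma card_extension : #|K| = (#|F| ^ e)%N.
Proof.
rewrite -[e in RHS]mul1n -card_mx.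
apply/esym/(bij_eq_card (f := fun w : 'rV[F]_e => proj (rVpoly w))).
exists (fun k => poly_rV (rep k)) => [w|k].
  by rewrite rep_proj ?rVpolyK // size_poly.
by rewrite poly_rV_K ?repK.
Qed.

Section Action.
Variables (n : nat) (S : 'M[F]_n).
Hypothesis phiS : peval S phi = 0.

(* The action of K on F^n in which the class of X acts by [S]. *)
Definition sigma (k : K) : 'M[F]_n := peval S (rep k).

Lemma sigma_proj g : sigma (proj g) = peval S g.
Proof.
apply/eqP; rewrite /sigma -subr_eq0 -rmorphB.
have /dvdpP[h ->] : phi %| rep (proj g) - g.
  by rewrite -proj_eq0 rmorphB repK subrr.
by rewrite rmorphM /= phiS mulr0.
Qed.

Lemma sigmaM k k' : sigma (k * k') = sigma k *m sigma k'.
Proof. by rewrite -{1}(repK k) -{1}(repK k') -rmorphM sigma_proj rmorphM. Qed.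

Lemma sigmaB k k' : sigma (k - k') = sigma k - sigma k'.
Proof. by rewrite -{1}(repK k) -{1}(repK k') -rmorphB sigma_proj rmorphB. Qed.

Definition comb m (v : {ffun 'I_m -> 'rV[F]_n}) (w : 'rV[K]_m) : 'rV[F]_n :=
  \sum_i v i *m sigma (w 0 i).

Lemma combB m v (w w' : 'rV[K]_m) : comb v (w - w') = comb v w - comb v w'.
Proof.
rewrite -sumrB; apply: eq_bigr => i _.
by rewrite !mxE sigmaB mulmxBr.
Qed.

Lemma combZ m v k (w : 'rV[K]_m) : comb v (k *: w) = comb v w *m sigma k.
Proof.
rewrite /comb mulmx_suml; apply: eq_bigr => i _.
by rewrite !mxE mulrC sigmaM mulmxA.
Qed.

Lemma comb_inj0 m v :
  (forall w : 'rV[K]_m, comb v w = 0 -> w = 0) -> injective (comb v).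
Proof.
move=> ker w w' E; apply/eqP; rewrite -subr_eq0; apply/eqP/ker.
by rewrite combB E subrr.
Qed.

Lemma comb0 m v : comb v (0 : 'rV[K]_m) = 0.
Proof. by rewrite -[0 in LHS](subrr 0) combB subrr. Qed.

(** Injectivity of [comb v] is linear independence over K. A longest independent family spans, since
    a vector outside its span could be adjoined. *)
Lemma basis_exists : exists m (v : {ffun 'I_m -> 'rV[F]_n}), bijective (comb v).
Proof.
pose P m := [exists v : {ffun 'I_m -> 'rV[F]_n}, injectiveb (comb v)].
have exP : exists m, P m.
  exists 0%N; apply/existsP; exists [ffun=> 0]; apply/injectiveP => w w' _.
  by apply/rowP => -[].
(* An injection of K^m into F^n gives m < #|K|^m <= #|F^n|. *)
have ubP m : P m -> (m <= #|{: 'rV[F]_n}|)%N.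
  case/existsP=> v /injectiveP inj; have := leq_card _ inj.
  apply: leq_trans; rewrite card_mx mul1n ltnW // ltn_expl //.
  exact: finNzRing_gt1.
case: (ex_maxnP exP ubP) => m /existsP[v /injectiveP inj] maxm.
exists m, v; suff surj u : exists w, comb v w = u.
  have [g gK] : {g | forall u, comb v (g u) = u}.
    exists (fun u => xchoose (let: ex_intro w E := surj u in
      ex_intro (fun w => comb v w == u) w (introT eqP E))) => u.
    exact/eqP/(xchooseP (P := fun w => comb v w == u)).
  by exists g => // w; apply: inj; rewrite gK.
have [/existsP[w /eqP]|nex] := boolP [exists w, comb v w == u]; first by exists w.
pose v' : {ffun 'I_m.+1 -> 'rV[F]_n} :=
  [ffun i => if unlift ord0 i is Some j then v j else u].
suff : P m.+1 by move/maxm; rewrite ltnn.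
apply/existsP; exists v'; apply/injectiveP/comb_inj0 => w.
pose w' : 'rV[K]_m := \row_j w 0 (lift ord0 j).
have -> : comb v' w = u *m sigma (w 0 ord0) + comb v w'.
  rewrite /comb big_ord_recl ffunE unlift_none; congr (_ + _).
  by apply: eq_bigr => j _; rewrite ffunE liftK mxE.
have [w0|w0] := eqVneq (w 0 ord0) 0.
  rewrite w0 -(rmorph0 proj) sigma_proj rmorph0 mulmx0 add0r -(comb0 v) => /inj w'0.
  apply/rowP => i; rewrite mxE; case: (unliftP ord0 i) => [j ->|-> //].
  by have /rowP/(_ j) := w'0; rewrite !mxE.
move/eqP; rewrite addr_eq0 => /eqP E; case/negP: nex; apply/existsP.
exists ((w 0 ord0)^-1 *: (0 - w')).
rewrite combZ combB comb0 sub0r -E -mulmxA -sigmaM divff //.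
by rewrite -(rmorph1 proj) sigma_proj rmorph1 mulmx1.
Qed.

End Action.

(** * Restriction of scalars from K^m to F^(m e) *)

Section Restriction.
Variable m : nat.
Local Notation n := (m * e)%N.

(** A vector of length m e is cut into [m] rows of length [e], each read as the coefficients of a
    representative modulo [phi]. *)
Definition toK (w : 'rV[F]_n) : 'rV[K]_m := \row_i proj (rVpoly (row i (vec_mx w))).
Definition ofK (v : 'rV[K]_m) : 'rV[F]_n := mxvec (\matrix_i poly_rV (rep (v 0 i))).

Lemma toKK : cancel toK ofK.
Proof.
move=> w; rewrite /ofK /toK -[RHS]vec_mxK; congr mxvec; apply/row_matrixP => i.
by rewrite rowK mxE rep_proj ?rVpolyK // size_poly.
Qed.

Lemma ofKK : cancel ofK toK.
Proof.
move=> v; apply/rowP => i; rewrite mxE mxvecK rowK poly_rV_K //.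
Qed.

Lemma toKD : {morph toK : u v / u + v}.
Proof. by move=> u v; apply/rowP => i; rewrite !mxE !linearD rmorphD. Qed.

Lemma toKZ a : {morph toK : u / a *: u >-> proj a%:P *: u}.
Proof.
by move=> u; apply/rowP => i; rewrite !mxE !linearZ /= -mul_polyC rmorphM.
Qed.

Lemma ofKD : {morph ofK : u v / u + v}.
Proof. by move=> u v; apply: (can_inj toKK); rewrite toKD !ofKK. Qed.

Lemma ofKZ a : {morph ofK : u / proj a%:P *: u >-> a *: u}.
Proof. by move=> u; apply: (can_inj toKK); rewrite toKZ !ofKK. Qed.

Definition rho (N : 'M[K]_m) : 'M[F]_n := lin1_mx (fun w => ofK (toK w *m N)).

Lemma toK_rho w N : toK (w *m rho N) = toK w *m N.
Proof.
rewrite mul_rV_lin1_fun ?ofKK //.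
  by move=> u v; rewrite toKD mulmxDl ofKD.
by move=> a u; rewrite toKZ -scalemxAl ofKZ.
Qed.

Lemma rho_ext (T : 'M[F]_n) N : (forall w, toK (w *m T) = toK w *m N) -> T = rho N.
Proof.
by move=> H; apply: mulrV_ext => w; apply: (can_inj toKK); rewrite H toK_rho.
Qed.

Lemma rhoM N N' : rho (N *m N') = rho N *m rho N'.
Proof. by apply/esym/rho_ext => w; rewrite mulmxA !toK_rho mulmxA. Qed.

Lemma rhoD N N' : rho (N + N') = rho N + rho N'.
Proof. by apply/esym/rho_ext => w; rewrite mulmxDr toKD !toK_rho mulmxDr. Qed.

Lemma rho1 : rho 1%:M = 1%:M.
Proof. by apply/esym/rho_ext => w; rewrite !mulmx1. Qed.

Lemma rho0 : rho 0 = 0.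
Proof. by apply: (addrI (rho 0)); rewrite -rhoD !addr0. Qed.

Lemma rho_inj : injective rho.
Proof.
move=> N N' E; apply: mulrV_ext => v.
by rewrite -(ofKK v) -!toK_rho E.
Qed.

Lemma rhoX N s : rho (N ^+ s) = rho N ^+ s.
Proof. by elim: s => [|s IH]; [exact: rho1 | rewrite !exprS -IH -!mulmxE rhoM]. Qed.

Lemma rho_unit T : T \in unitmx -> rho T \in unitmx.
Proof.
move=> Tu; have : rho T *m rho (invmx T) = 1%:M by rewrite -rhoM mulmxV ?rho1.
by case/mulmx1_unit.
Qed.

Lemma peval_rho (A : 'M[K]_m) g :
  peval (rho A) g = rho (peval A (map_poly (proj \o polyC) g)).
Proof.
elim/poly_ind: g => [|g c IH]; first by rewrite !rmorph0 rho0.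
rewrite !rmorphD !rmorphM /= map_polyX map_polyC !pevalX !pevalC -!mulmxE.
rewrite rhoD rhoM IH; congr (_ + _).
apply: rho_ext => w; rewrite !mul_mx_scalar; exact: toKZ.
Qed.

Let x := proj 'X.

(** Commuting with the class of X means commuting with every polynomial in it, that is with all of
    K, since [proj] is onto. *)
Lemma rho_centralizer T : T *m rho x%:M = rho x%:M *m T -> exists N, T = rho N.
Proof.
move=> comm; pose g (v : 'rV[K]_m) := toK (ofK v *m T).
have gD : {morph g : u v / u + v}.
  by move=> u v; rewrite /g ofKD mulmxDl toKD.
have gx v : g (x *: v) = x *: g v.
  rewrite /g; have -> : ofK (x *: v) = ofK v *m rho x%:M.
    by apply: (can_inj toKK); rewrite toK_rho !ofKK mul_mx_scalar.
  by rewrite -mulmxA -comm mulmxA toK_rho mul_mx_scalar.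
have gC a v : g (proj a%:P *: v) = proj a%:P *: g v.
  by rewrite /g ofKZ -scalemxAl toKZ.
have gP p v : g (proj p *: v) = proj p *: g v.
  elim/poly_ind: p v => [|p c IH] v.
    by rewrite -(polyC0 F) gC.
  by rewrite !rmorphD !rmorphM /= !scalerDl gD gC -!scalerA IH gx.
exists (lin1_mx g); apply: rho_ext => w.
rewrite mul_rV_lin1_fun // => [|k u]; first by rewrite /g toKK.
by rewrite -(repK k) gP.
Qed.

(** Through [S] the space F^n is a K-vector space, and counting elements forces its dimension to be
    [m]. A K-basis then carries multiplication by [x] to [S]. *)
Lemma rho_similar S : peval S phi = 0 ->
  exists2 P : 'M[F]_n, P \in unitmx & rho x%:M *m P = P *m S.
Proof.
move=> phiS; have [m' [v vbij]] := basis_exists phiS.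
have mE : m' = m.
  have := bij_eq_card vbij; rewrite !card_mx !mul1n card_extension -expnM.
  have q1 := finNzRing_gt1 F.
  by move/eqP; rewrite eqn_exp2l // [(m * e)%N]mulnC eqn_pmul2l // => /eqP.
subst m'; pose c := comb S v.
have cD : {morph c : u w / u + w}.
  move=> u w; have cN w' : c (- w') = - c w'.
    by rewrite -[- w']sub0r /c combB // comb0 // sub0r.
  by have := combB phiS v u (- w); rewrite opprK -/c cN opprK.
have cP w : w *m lin1_mx (c \o toK) = c (toK w).
  apply: (mul_rV_lin1_fun (f := c \o toK)) => [u u'|a u] /=.
    by rewrite toKD cD.
  by rewrite toKZ /c combZ // sigma_proj // pevalC mul_mx_scalar.
exists (lin1_mx (c \o toK)).
  rewrite -row_free_unit -kermx_eq0; apply/eqP/row_matrixP => i.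
  have /sub_kermxP := row_sub i (kermx (lin1_mx (c \o toK))).
  rewrite cP row0 => E; apply: (can_inj toKK).
  apply: (bij_inj vbij); rewrite -/c E.
  have -> : toK 0 = 0 by apply: (addrI (toK 0)); rewrite -toKD !addr0.
  by rewrite /c comb0.
apply: mulrV_ext => w; rewrite !mulmxA !cP toK_rho mul_mx_scalar.
by rewrite /c combZ // /x sigma_proj // pevalX.
Qed.

(** Over K the polynomial [phi] is a multiple of X - x, so its s-th power at x + N contains the
    factor N^s. *)
Lemma peval_phi_exp (N : 'M[K]_m) s : N ^+ s = 0 ->
  peval (rho (x%:M + N)) (phi ^+ s) = 0.
Proof.
move=> N0; rewrite peval_rho rmorphXn /=.
have /factor_theorem[r ->] : root (map_poly (proj \o polyC) phi) x.
  suff H g : (map_poly (proj \o polyC) g).[x] = proj g.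
    by rewrite /root H proj_eq0 dvdpp.
  elim/poly_ind: g => [|g c IH]; first by rewrite !rmorph0 horner0.
  by rewrite !rmorphD !rmorphM /= map_polyX map_polyC !hornerE IH.
rewrite exprMn rmorphM /= !rmorphXn rmorphB /= pevalX pevalC addrAC subrr add0r.
by rewrite N0 mulr0 rho0.
Qed.

(** With A = x + N and Q = #|K|^k, Frobenius applied to X - x gives 0 = N^Q = A^Q - x. *)
Lemma exp_card_scalar_nil (N : 'M[K]_m) s k : N ^+ s = 0 -> (s <= #|K| ^ k)%N ->
  (x%:M + N) ^+ (#|K| ^ k) = x%:M.
Proof.
move=> N0 sk; set A := x%:M + N.
have NA : N = peval A ('X - x%:P).
  by rewrite rmorphB /= pevalX pevalC /A addrAC subrr add0r.
have : N ^+ (#|K| ^ k) = 0 by rewrite -(subnKC sk) exprD N0 mul0r.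
rewrite NA -rmorphXn /= poly_exp_card rmorphB /= comp_polyX comp_polyC.
by rewrite rmorphB /= rmorphXn /= pevalX pevalC => /eqP; rewrite subr_eq0 => /eqP.
Qed.

End Restriction.

(* The semisimple part is [A ^+ (#|K| ^ s)], a polynomial in [A]. *)
Lemma jordan_split n (A : 'M[F]_n) s : peval A (phi ^+ s) = 0 ->
  exists S N, [/\ A = S + N, peval S phi = 0, N ^+ s = 0 & S *m N = N *m S].
Proof.
move=> A0; pose k := (#|K| ^ s)%N.
have kE : k = (#|F| ^ (e * s))%N by rewrite /k card_extension -expnM.
have sk : (s <= k)%N by rewrite ltnW // ltn_expl // finNzRing_gt1.
exists (peval A 'X^k), (peval A ('X - 'X^k)).
have /dvdpP[g gE] : phi %| 'X - 'X^k.
  rewrite -proj_eq0 rmorphB rmorphXn /= subr_eq0 eq_sym; apply/eqP.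
  by rewrite /k; elim: (s) => [|j IH]; rewrite ?expr1 // expnS exprM expf_card.
split.
- by rewrite -rmorphD -[LHS]pevalX; congr peval; rewrite addrC subrK.
(* Here phi(X^k) = phi^k by Frobenius, and it kills [A] because [k >= s]. *)
- rewrite -peval_comp kE -poly_exp_card -kE -(subnKC sk) exprD rmorphM /= A0.
  by rewrite mul0r.
- by rewrite gE -rmorphXn /= exprMn rmorphM /= A0 mulr0.
- by rewrite !mulmxE -!rmorphM mulrC.
Qed.

Let x := proj 'X.

(** Conjugating rho(x + N) by [P] reaches every matrix killed by phi^s, and the fibres are torsors
    for GL_m(K): a change of basis between two such forms is K-linear. *)
Lemma card_extension_count m s :
  (GLcard F (m * e) * nilcount K s m =
   GLcard K m * pcount (phi ^+ s) (m * e))%N.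
Proof.
rewrite /GLcard /nilcount -[in LHS]card_pair_set.
pose h (y : 'M[F]_(m * e) * 'M[K]_m) := invmx y.1 *m rho (x%:M + y.2) *m y.1.
pose act (T : 'M[K]_m) (y : 'M[F]_(m * e) * 'M[K]_m) :=
  (rho T *m y.1, T *m y.2 *m invmx T).
have sk : (s <= #|K| ^ s)%N by rewrite ltnW // ltn_expl // finNzRing_gt1.
apply: (@card_torsor _ _ _ _ _ _ h act).
- case=> P N; rewrite !inE /= => /andP[Pu /eqP N0].
  by rewrite /h /= peval_conj // peval_phi_exp // mulmx0 mul0mx.
- move=> A; rewrite inE => /eqP /jordan_split[S [N [AE phiS N0 SN]]].
  have [P Pu PS] := rho_similar phiS.
  have [N' NE] : exists N', P *m N *m invmx P = rho N'.
    apply: rho_centralizer; rewrite -/x.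
    have -> : rho x%:M = P *m S *m invmx P by rewrite -PS mulmxK.
    by rewrite !mulmxA !mulmxKV // -!(mulmxA P) SN.
  exists (P, N').
    rewrite inE /= Pu; apply/eqP/rho_inj; rewrite rhoX -NE rho0.
    exact: expr_conjmx.
  apply/conj_eq => //=; rewrite rhoD -NE mulmxDl PS mulmxKV // AE mulmxDr.
  by [].
- move=> T [P N]; rewrite !inE /= => Tu /andP[Pu /eqP N0].
  have ru := rho_unit Tu.
  rewrite unitmx_mul ru Pu expr_conjmx // eqxx; split => //.
  apply/conj_eq; rewrite /= ?unitmx_mul ?ru //.
  rewrite /h /= !mulmxA mulmxK // -!rhoM; congr (rho _ *m _).
  by rewrite mulmxDl mulmxDr mulmxKV // scalar_mxC.
- case=> P N; rewrite inE => /andP[/= Pu _] T T' _ _ [+ _].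
  by move/(congr1 (mulmx^~ (invmx P))); rewrite !mulmxK // => /rho_inj.
- case=> P N [P' N']; rewrite !inE /h /=.
  case/andP=> Pu /eqP N0 /andP[Pu' /eqP N0'] E.
  pose T := P' *m invmx P.
  have Tu : T \in unitmx by rewrite unitmx_mul Pu' unitmx_inv.
  have TE : T *m rho (x%:M + N) = rho (x%:M + N') *m T.
    have -> : rho (x%:M + N) = P *m (invmx P' *m rho (x%:M + N') *m P') *m invmx P.
      by rewrite -E !mulmxA mulmxV // mul1mx mulmxK.
    by rewrite /T !mulmxA mulmxKV // mulmxV // mul1mx.
  (* The power [#|K| ^ s] turns both x + N and x + N' into x. *)
  have Tx : T *m rho x%:M = rho x%:M *m T.
    have := peval_intertwine 'X^(#|K| ^ s) TE.
    by rewrite !rmorphXn /= !pevalX -!rhoX (exp_card_scalar_nil N0 sk) (exp_card_scalar_nil N0' sk).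
  have [t tE] := rho_centralizer Tx.
  (* The inverse of [T] commutes with x as well, so it too comes from K, which makes [t] invertible
     over K. *)
  have [t' tE'] : exists t', invmx T = rho t'.
    apply: rho_centralizer; apply: (canLR (mulKmx Tu)).
    by rewrite mulmxA Tx mulmxK.
  have tu : t \in unitmx.
    have : t *m t' = 1%:M by apply: rho_inj; rewrite rhoM -tE -tE' mulmxV // rho1.
    by case/mulmx1_unit.
  exists t; first by rewrite inE.
  rewrite /act /= -tE /T mulmxKV //; congr (_, _).
  move: TE; rewrite tE -!rhoM => /rho_inj; rewrite mulmxDl mulmxDr scalar_mxC.
  by move/addrI->; rewrite mulmxK.
Qed.

Lemma pser_irreducible s n :
  pser (phi ^+ s) n = factor_ps #|F| e s n.
Proof.
rewrite /factor_ps; case: eqP => [->|_]; first exact: pser0.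
rewrite /pser.
case: ifP => [/dvdnP[m ->]|/negP ndv].
  rewrite mulnK // -(nilpotent_partition_sum m s card_extension).
  apply/eqP; rewrite eqr_div ?GLcard_neq0 //; apply/eqP.
  by rewrite -!natrM mulnC -card_extension_count mulnC.
(* A matrix killed by phi^s would make F^n a K-vector space, so [e] would divide [n]. *)
suff -> : pcount (phi ^+ s) n = 0%N by rewrite mul0r.
apply/eqP; rewrite cards_eq0; apply/eqP/setP => A; rewrite !inE.
apply/negP => /eqP /jordan_split[S [N [_ phiS _ _]]]; apply: ndv.
have [m [v vbij]] := basis_exists phiS.
have := bij_eq_card vbij; rewrite !card_mx !mul1n card_extension -expnM.
by move/eqP; rewrite eqn_exp2l ?finNzRing_gt1 // => /eqP<-; rewrite dvdn_mulr.
Qed.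

End Extension.

Lemma extension_exists (F : finFieldType) (phi : {poly F}) :
  irreducible_poly phi -> phi \is monic ->
  exists (K : finFieldType) (proj : {rmorphism {poly F} -> K}) (rep : K -> {poly F}),
    [/\ cancel rep proj, forall k, (size (rep k) <= (size phi).-1)%N &
        forall g, (proj g == 0) = (phi %| g)].
Proof.
move=> irr mon; pose mi : monic_irreducible_poly phi := (irr, mon).
have s1 : (1 < size phi)%N by exact: irr.1.
have mE : mk_monic phi = phi := mk_monicE mi.
pose K : finFieldType := {poly %/ phi with mi}.
pose proj : {rmorphism {poly F} -> K} := in_qpoly phi.
exists K, proj, (fun k : K => (k : {poly %/ phi}) : {poly F}); split.
- by move=> k; apply: val_inj; apply: in_qpoly_small; apply: size_mk_monic.
- by move=> k; rewrite -{2}mE -ltnS prednK ?size_mk_monic // mE ltnW.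
- by move=> g; rewrite -val_eqE /= mE /dvdp (Pdiv.IdomainMonic.modpE mon).
Qed.

Lemma pser_irreducible_power (F : finFieldType) (phi : {poly F}) s n :
  irreducible_poly phi -> phi \is monic ->
  pser (phi ^+ s) n = factor_ps #|F| (size phi).-1 s n.
Proof.
move=> irr mon; have [K [proj [rep [repK srep p0]]]] := extension_exists irr mon.
have s1 : (1 < size phi)%N := irr.1.
apply: (pser_irreducible repK srep _ p0); first by rewrite prednK // ltnW.
by case: (size phi) s1 => [|[]].
Qed.

(** * Factorization of X^t - 1 *)

Section Factorization.
Variable F : finFieldType.

(** A divisor of least size above 1 is irreducible. The search runs over the finite type of
    polynomials of size at most [size g]. *)
Lemma irreducible_divisor (g : {poly F}) : (1 < size g)%N ->
  exists f, [/\ irreducible_poly f, f \is monic & f %| g].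
Proof.
move=> sg; have g0 : g != 0 by rewrite -size_poly_gt0 ltnW.
pose P k := (1 < k)%N &&
  [exists f : {poly_(size g) F}, (size (f : {poly F}) == k) && ((f : {poly F}) %| g)].
have inP (f : {poly F}) : (1 < size f)%N -> f %| g -> P (size f).
  move=> sf fg; rewrite /P sf; apply/existsP; exists (npolyp (size g) f).
  by rewrite npolypK ?dvdp_leq // eqxx.
have exP : exists k, P k by exists (size g); apply: inP.
case: (ex_minnP exP) => k /andP[k1 /existsP[f /andP[/eqP sf fg]]] mink.
have f0 : (f : {poly F}) != 0 by rewrite -size_poly_gt0 sf ltnW.
have lc0 : (lead_coef f)^-1 != 0 by rewrite invr_eq0 lead_coef_eq0.
exists ((lead_coef f)^-1 *: (f : {poly F})).
have eqf : (lead_coef f)^-1 *: (f : {poly F}) %= f by apply: eqp_scale.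
split; last by rewrite (eqp_dvdl _ eqf).
  split; first by rewrite size_scale // sf.
  move=> h sh; rewrite (eqp_dvdr _ eqf) => hf.
  apply: (eqp_trans (y := polyn f)); last by rewrite eqp_sym.
  rewrite -(dvdp_size_eqp hf) eqn_leq dvdp_leq //= sf.
  apply: mink; apply: inP; last exact: dvdp_trans fg.
  have : h != 0 by apply: contraTneq hf => ->; rewrite dvd0p.
  by rewrite -size_poly_gt0; case: (size h) sh => [|[]].
by rewrite monicE lead_coefZ mulVf // lead_coef_eq0.
Qed.

Lemma monic_factorization (g : {poly F}) : g \is monic ->
  exists2 fs : seq {poly F},
    (forall f, f \in fs -> irreducible_poly f /\ f \is monic) &
    g = \prod_(f <- fs) f.
Proof.
elim: {g}_.+1 {-2}g (ltnSn (size g)) => // n IH g; rewrite ltnS => sgn mon.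
have [s1|s1] := leqP (size g) 1.
  exists [::] => //; rewrite big_nil.
  by move: mon; rewrite (size1_polyC s1) monicE lead_coefC => /eqP->.
have [f [irr fm fg]] := irreducible_divisor s1.
have [h gE] := dvdpP _ _ fg.
have hm : h \is monic by move: mon; rewrite gE monicMr.
have [|fs fsP hE] := IH h _ hm.
  apply: leq_trans sgn; rewrite gE size_Mmonic ?monic_neq0 //.
  have sf : (1 < size f)%N := irr.1.
  by move: sf; move: (size f) (size h) => [|[|a]] b; rewrite ?addnS ?ltnS ?leq_addr.
exists (f :: fs); last by rewrite big_cons -hE mulrC.
by move=> k; rewrite inE => /predU1P[->|/fsP].
Qed.

Lemma separable_prod_coprime (I : eqType) (s : seq I) (G : I -> {poly F}) i j :
  separable_poly (\prod_(i <- s) G i) -> i \in s -> j \in s -> i != j ->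
  coprimep (G i) (G j).
Proof.
move=> sep si sj ij; move: sep; rewrite (big_rem i) //= separable_mul.
case/and3P=> _ _; rewrite (big_rem j) /= ?coprimepMr; first by case/andP.
by apply: rem_mem; rewrite // eq_sym.
Qed.

Lemma pser1 n : pser (1 : {poly F}) n = ps_one n.
Proof.
case: n => [|n]; first exact: pser0.
rewrite /pser /ps_one /=.
suff -> : pcount (1 : {poly F}) n.+1 = 0%N by rewrite mul0r.
apply/eqP; rewrite cards_eq0; apply/eqP/setP => A; rewrite !inE rmorph1.
exact: oner_eq0.
Qed.

Lemma pser_prod (I : Type) (s : seq I) (G : I -> {poly F}) m n :
  separable_poly (\prod_(i <- s) G i) ->
  pser ((\prod_(i <- s) G i) ^+ m) n = ps_prod [seq pser (G i ^+ m) | i <- s] n.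
Proof.
elim: s n => [|i s IH] n; first by rewrite big_nil expr1n pser1.
rewrite big_cons separable_mul => /and3P[_ sep cop].
rewrite exprMn pserM ?coprimep_expl ?coprimep_expr //=.
by apply: eq_bigr => j _; rewrite IH.
Qed.

End Factorization.

Lemma eq_ps_prod (I : eqType) (s : seq I) (f g : I -> ps) n :
  (forall i, i \in s -> f i =1 g i) ->
  ps_prod [seq f i | i <- s] n = ps_prod [seq g i | i <- s] n.
Proof.
elim: s n => //= i s IH n fg; apply: eq_bigr => j _.
rewrite fg ?mem_head // IH // => k ks; apply: fg.
by rewrite inE ks orbT.
Qed.

Lemma ps_prod_const (I : eqType) (s : seq I) (f : I -> ps) (g : ps) n :
  (forall i, i \in s -> f i =1 g) ->
  ps_prod [seq f i | i <- s] n = ps_pow g (size s) n.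
Proof.
move=> fg; rewrite (eq_ps_prod (g := fun=> g)) //.
by elim: s n {fg} => //= i s IH n; apply: eq_bigr => j _; rewrite IH.
Qed.

Lemma mord_eq q d e : (0 < e <= d)%N -> q ^ e = 1 %[mod d] ->
  (forall k, (0 < k < e)%N -> q ^ k <> 1 %[mod d]) -> mord q d = e.
Proof.
case/andP=> e0 ed qe min; rewrite /mord.
have -> : iota 1 d = iota 1 e.-1 ++ e :: iota e.+1 (d - e).
  rewrite -[e :: _]/(iota e (d - e).+1).
  have -> : d = (e.-1 + (d - e).+1)%N by lia.
  by rewrite iotaD; congr (_ ++ iota _ _); lia.
rewrite filter_cat (_ : filter _ (iota 1 _) = [::]) /= ?qe ?eqxx //.
apply/eqP; rewrite -size_eq0 size_filter eqn0Ngt -has_count; apply/hasPn => k.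
by rewrite mem_iota => kb; apply/eqP/min; lia.
Qed.

(** * Cyclotomic polynomials over F and the degrees of their irreducible factors *)

Section Degree.
Variables (F : finFieldType) (d : nat).
Hypothesis d_unit : d%:R != 0 :> F.

Definition PhiF k : {poly F} := map_poly intr 'Phi_k.

Lemma prod_PhiF k : (0 < k)%N -> \prod_(j <- divisors k) PhiF j = 'X^k - 1.
Proof.
move=> k0; have := congr1 (map_poly (intr : int -> F)) (prod_Cyclotomic k0).
by rewrite rmorph_prod /= rmorphB /= map_polyXn rmorph1.
Qed.

Lemma PhiF_monic k : PhiF k \is monic.
Proof. by rewrite monic_map ?Cyclotomic_monic. Qed.

Lemma size_PhiF k : size (PhiF k) = (totient k).+1.
Proof.
rewrite -size_Cyclotomic size_map_poly_id0 //.
by rewrite (monicP (Cyclotomic_monic k)) rmorph1 oner_eq0.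
Qed.

Lemma d_gt0 : (0 < d)%N.
Proof. by case: d d_unit => //; rewrite eqxx. Qed.

(** The class [x] of X is a primitive d-th root of unity, so the k-th Frobenius power fixes [x]
    exactly when q^k = 1 modulo d. As [x] generates K over F, the least such positive [k] is the
    degree of K. *)
Lemma degree_irreducible_PhiF (phi : {poly F}) :
  irreducible_poly phi -> phi \is monic -> phi %| PhiF d ->
  (size phi).-1 = mord #|F| d.
Proof.
move=> irr mon dvd_phi.
have [K [proj [rep [repK srep p0]]]] := extension_exists irr mon.
have s1 : (1 < size phi)%N := irr.1.
set e := (size phi).-1; have sphi : size phi = e.+1 by rewrite prednK // ltnW.
have cK : #|K| = (#|F| ^ e)%N := card_extension repK srep sphi p0.
pose x := proj 'X.
have dX : phi %| 'X^d - 1.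
  apply: dvdp_trans dvd_phi _; rewrite -(prod_PhiF d_gt0).
  by rewrite (big_rem d) ?dvdp_mulr // -dvdn_divisors ?d_gt0.
have xd : x ^+ d = 1.
  by apply/eqP; rewrite -subr_eq0 -rmorphXn -(rmorph1 proj) -rmorphB p0.
(* If the order [m] of [x] were a proper divisor of [d], then [phi] would divide both [PhiF d] and
   some [PhiF d'] with d' dividing [m], yet these are coprime since X^d - 1 is separable. *)
have prim : d.-primitive_root x.
  have [m pm md] := prim_order_exists d_gt0 xd.
  have [-> //|nmd] := eqVneq d m; exfalso.
  have m0 := prim_order_gt0 pm.
  have : proj ('X^m - 1) == 0.
    by rewrite rmorphB rmorphXn rmorph1 -/x (prim_expr_order pm) subrr.
  rewrite -(prod_PhiF m0) rmorph_prod prodf_seq_eq0 => /hasP[d' d'm /= pd'].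
  have d'd : d' \in divisors d.
    by rewrite -dvdn_divisors ?d_gt0 // (dvdn_trans _ md) // dvdn_divisors.
  have ne : d != d'.
    apply: contra_neq nmd => E; apply/eqP; rewrite eqn_dvd md E andbT.
    by rewrite dvdn_divisors.
  have := separable_Xn_sub_1 d_unit; rewrite -(prod_PhiF d_gt0) => sep.
  have dd : d \in divisors d by rewrite -dvdn_divisors ?d_gt0.
  have /coprimepP/(_ phi dvd_phi) := separable_prod_coprime sep dd d'd ne.
  by rewrite -p0 pd' -size_poly_eq1 => /(_ isT); rewrite sphi; lia.
have modE k : (#|F| ^ k == 1 %[mod d]) = (x ^+ (#|F| ^ k) == x).
  by rewrite -(eq_prim_root_expr prim) expr1.
have qgt1 := finNzRing_gt1 F.
have e0 : (0 < e)%N by lia.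
apply/esym/mord_eq.
- rewrite e0 /=; have := dvdp_leq _ dX; rewrite sphi size_XnsubC ?d_gt0 // => H.
  by apply: H; rewrite -size_poly_gt0 size_XnsubC ?d_gt0.
- by apply/eqP; rewrite modE -cK expf_card.
move=> k /andP[k0 ke] /eqP; rewrite modE => /eqP xk.
have all_fixed (y : K) : y ^+ (#|F| ^ k) = y.
  rewrite -(repK y) -rmorphXn poly_exp_card.
  elim/poly_ind: (rep y) => [|g c IH]; first by rewrite comp_poly0.
  by rewrite comp_poly_MXaddC !rmorphD !rmorphM IH /= rmorphXn -/x /= xk.
have qk1 : (1 < #|F| ^ k)%N by rewrite -(expn0 #|F|) ltn_exp2l.
have sz : size ('X^(#|F| ^ k) - 'X : {poly K}) = (#|F| ^ k).+1.
  by rewrite size_polyDl size_polyXn // size_polyN size_polyX ltnS.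
(* All #|F|^e elements of K would be roots of a polynomial of degree #|F|^k, with k < e. *)
have := @max_poly_roots K ('X^(#|F| ^ k) - 'X) (enum K).
rewrite -size_poly_gt0 sz enum_uniq -cardE cK => /(_ isT) H.
have : (#|F| ^ e < (#|F| ^ k).+1)%N.
  apply: H => //; apply/allP => y _.
  by rewrite rootE !hornerE all_fixed subrr.
by rewrite ltnS leq_exp2l // leqNgt ke.
Qed.

(** All irreducible factors have degree [mord #|F| d], so the degree of [PhiF d] gives their number,
    and they contribute equal series. *)
Lemma pser_PhiF s n :
  pser (PhiF d ^+ s) n =
  ps_pow (factor_ps #|F| (mord #|F| d) s) (totient d %/ mord #|F| d) n.
Proof.
have [fs fsP fsE] := monic_factorization (PhiF_monic d).
have deg f : f \in fs -> (size f).-1 = mord #|F| d.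
  move=> ffs; have [irr mon] := fsP f ffs; apply: degree_irreducible_PhiF => //.
  by rewrite fsE (big_rem f) //= dvdp_mulr.
have := separable_Xn_sub_1 d_unit; rewrite -(prod_PhiF d_gt0).
rewrite (big_rem d) -?dvdn_divisors ?d_gt0 //= separable_mul => /andP[sep _].
have tot : totient d = (size fs * mord #|F| d)%N.
  have -> : totient d = (size (PhiF d)).-1 by rewrite size_PhiF.
  rewrite fsE; elim: (fs) fsP deg => [|f k IH] fsP deg.
    by rewrite big_nil size_poly1.
  have [irr mon] := fsP f (mem_head _ _).
  have km : \prod_(f <- k) f \is monic.
    rewrite big_seq; apply: monic_prod => h hk.
    by have [|] := fsP h; rewrite // inE hk orbT.
  have ih : (size (\prod_(f <- k) f)).-1 = (size k * mord #|F| d)%N.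
    by apply: IH => h hk; [apply: fsP | apply: deg]; rewrite inE hk orbT.
  rewrite big_cons size_Mmonic ?monic_neq0 // mulSn -ih -(deg f) ?mem_head //.
  have sf : (1 < size f)%N := irr.1.
  have sk : (0 < size (\prod_(f <- k) f)%R)%N by rewrite size_poly_gt0 monic_neq0.
  by rewrite -[in LHS](prednK sk) -[in LHS](prednK (ltnW sf)) addnS.
have md : (0 < mord #|F| d)%N.
  rewrite lt0n; apply: contra_eqN (tot) => /eqP->.
  by rewrite muln0 -lt0n totient_gt0 d_gt0.
rewrite fsE (@pser_prod _ _ fs id) -?fsE // tot mulnK //.
apply: ps_prod_const => f ffs n' /=; have [irr mon] := fsP f ffs.
by rewrite pser_irreducible_power // deg.
Qed.

End Degree.

Theorem mainTheorem8 (p k : nat) (F : finFieldType) (M t r : nat) :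
  prime p -> odd p -> (0 < k)%N -> #|F| = (p ^ k)%N ->
  (2 <= M)%N -> M = (t * p ^ r)%N -> ~~ (p %| t)%N ->
  forall n : nat, lhs_ps F M n = rhs_ps (p ^ k) t (p ^ r) n.
Proof.
move=> p_pr _ k0 cF M2 ME pt n.
have pF : p \in [pchar F] := card_finPcharP cF p_pr.
have unit_dvd d : (d %| t)%N -> d%:R != 0 :> F.
  move=> dt; rewrite -(dvdn_pcharf pF); apply: contra pt => pd.
  exact: dvdn_trans pd dt.
have t0 : (0 < t)%N by case: (t) pt => //; rewrite dvdn0.
have XM : ('X^M - 1 : {poly F}) = ('X^t - 1) ^+ (p ^ r).
  have pn : [pchar {poly F}].-nat (p ^ r)%N.
    rewrite (eq_pnat _ (pchar_poly F)) (eq_pnat _ (pcharf_eq pF)).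
    by rewrite pnatX pnat_id.
  by rewrite exprDn_pchar // exprNn_pchar // expr1n -exprM -ME.
transitivity (pser ('X^M - 1 : {poly F}) n).
  rewrite /lhs_ps; case: eqP => [->|_]; first by rewrite pser0.
  rewrite /pser; congr (_%:R / _); apply: eq_card => A; rewrite !inE.
  rewrite rmorphB /= rmorphXn rmorph1 /= pevalX subr_eq0 andb_idl // => /eqP AM.
  (* The relation A^M = 1 exhibits A^(M-1) as an inverse of [A]. *)
  have : A *m A ^+ M.-1 = 1%:M by rewrite mulmxE -exprS prednK // ltnW.
  by case/mulmx1_unit.
rewrite XM -(prod_PhiF F t0) pser_prod.
  apply: eq_ps_prod => d; rewrite -dvdn_divisors // => dt n'.
  by rewrite pser_PhiF ?unit_dvd // cF.
by rewrite prod_PhiF // separable_Xn_sub_1 // unit_dvd.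
Qed.
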